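(* Let $U$ be a $\mathcal K^{2,\delta}_{loc}\cap\mathcal C^3$-regular ($\delta>0$) progressive utility whose local characteristics $(\beta,\gamma)$ satisfy the HJB constraints $$\gamma_x(t,x)=-U_{xx}(t,x)\sigma^*_t(x)+\tilde\sigma^*_t(U_x(t,x)),\qquad\beta(t,x)=-U_x(t,x)\,x\,r_t+\tfrac12U_{xx}(t,x)\|\sigma^*_t(x)\|^2,$$ where, with $x\kappa^*_t(x)=-\frac1{U_{xx}(t,x)}\big(U_x(t,x)\eta^{\mathcal R}_t+\gamma^{\mathcal R}_x(t,x)\big)$, $$\mu^*_t(x)=r_tx+x\kappa^*_t(x).\eta^{\mathcal R}_t,\quad\sigma^*_t(x)=x\kappa^*_t(x),\quad\tilde\mu^*_t(y)=-r_ty,\quad\tilde\sigma^*_t(y)=-\eta^{\mathcal R}_ty+\gamma^\perp_x(t,-\widetilde U_y(t,y)),$$ $$\widehat L^*_{t,x}=\tfrac12\partial_x\big(\|\sigma^*_t(x)\|^2\partial_x\big)-\mu^*_t(x)\partial_x.$$ Then the marginal utility $U_x$ is a decreasing solution of the SPDE $$dU_x(t,x)=\tilde\sigma^*_t(U_x(t,x)).dW_t+\tilde\mu^*_t(U_x(t,x))dt-\partial_xU_x(t,x)\,\sigma^*_t(x).\big(dW_t+\tilde\sigma^*_y(t,U_x(t,x))dt\big)+\widehat L^*_{t,x}(U_x)\,dt,$$ where $\tilde\sigma^*_y(t,y)=\partial_y\tilde\sigma^*_t(y)$.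
   Context: Setting: $(\Omega,\mathbb F=(\mathcal F_t)_{t\ge0},\mathbb P)$ is a filtered probability space with right-continuous complete filtration and trivial $\mathcal F_0$, carrying an $n$-dimensional Brownian motion $W$; a dot denotes the Euclidean inner product. A progressive random field is a jointly measurable map $(t,x,\omega)\mapsto \phi(t,x)(\omega)$, $t\ge 0$, $x>0$, such that $\phi(\cdot,x)$ is progressive for each $x$; it has a property in $x$ if, outside a single null set, for every $t\ge0$ the map $x\mapsto\phi(t,x)(\omega)$ has it. Subscripts $x,y$ denote spatial derivatives. An It\^o random field $F(t,x)=F(0,x)+\int_0^t\phi(s,x)ds+\int_0^t\psi(s,x).dW_s$ has local characteristics $(\phi,\psi)$. For a compact $K\subset(0,\infty)$ put $$\|\phi\|_{m,\delta:K}(t)=\sup_{x\in K}\frac{\|\phi(t,x)\|}{x}+\sum_{1\le j\le m}\sup_{x\in K}\|\partial_x^j\phi(t,x)\|+\sup_{x\neq y\in K}\frac{\|\partial_x^m\phi(t,x)-\partial_x^m\phi(t,y)\|}{|x-y|^\delta}.$$ $\mathcal K^{m,\delta}_{loc}$ (resp. $\overline{\mathcal K}^{m,\delta}_{loc}$) is the set of progressive random fields $C^{m,\delta}$ in $x$ with $\int_0^T\|\phi\|_{m,\delta:K}dt<\infty$ (resp. $\int_0^T\|\phi\|_{m,\delta:K}^2dt<\infty$) a.s. for all compact $K\subset(0,\infty)$, $T>0$. $F$ is $\mathcal K^{m,\delta}_{loc}$-regular (a $\mathcal K^{m,\delta}_{loc}$-semimartingale) if $F(0,\cdot)$ is $C^{m,\delta}$,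 its drift part is of class $\mathcal K^{m,\delta}_{loc}$ and its martingale part of class $\overline{\mathcal K}^{m,\delta}_{loc}$. $\mathcal C^3$ means $C^3$ in $x$. A progressive utility is a continuous progressive random field $U$ on $(0,\infty)$ which is non-negative, strictly increasing and strictly concave in $x$, is $C^2$ in $x$ with continuous $U_x,U_{xx}$, and satisfies $U(t,x)\to0$ and $U_x(t,x)\to\infty$ as $x\to0$, $U_x(t,x)\to0$ as $x\to\infty$. The conjugate is $\widetilde U(t,y)=\sup_{x>0}(U(t,x)-xy)$, $y>0$, and $-\widetilde U_y(t,\cdot)=U_x(t,\cdot)^{-1}$. Market: $(r_t)$ is a progressive short rate and $(\eta_t)$ an $n$-dimensional progressive risk premium, with minimal integrability assumptions ($\int_0^T(|r_t|+\|\eta_t\|^2)dt<\infty$ a.s.); $(\mathcal R_t)$ is a progressive family of vector subspaces of $\mathbb R^n$. For $v\in\mathbb R^n$, $v^{\mathcal R}$ is the orthogonal projection onto $\mathcal R_t$ and $v^\perp$ that onto $\mathcal R_t^\perp$; $\eta^{\mathcal R}_t$ is the projection of $\eta_t$. *)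

(* Defs.v *)
From HB Require Import structures.
From mathcomp Require Import all_boot all_order all_algebra.
From mathcomp Require Import all_classical all_reals all_analysis.

Set Implicit Arguments.
Unset Strict Implicit.
Unset Printing Implicit Defensive.

Import Order.TTheory GRing.Theory Num.Theory.
Import numFieldNormedType.Exports.

Local Open Scope ring_scope.
Local Open Scope classical_set_scope.

(** * Euclidean structure of ['rV[R]_n] *)

Section Euclidean.
Context {R : realType} {n : nat}.
Implicit Types (u v : 'rV[R]_n) (A : set 'rV[R]_n).

Definition dot u v : R := \sum_(i < n) u ord0 i * v ord0 i.

(* The library norm [`| v |] of a row vector is the sup norm. *)
Definition enorm v : R := Num.sqrt (dot v v).

Definition orthogonal_set A : set 'rV[R]_n :=
  [set u | forall v, A v -> dot u v = 0].

(* The default value 0 is never used when [A] is a vector subspace. *)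
Definition orthogonal_projection A v : 'rV[R]_n :=
  xget 0 [set p | A p /\ orthogonal_set A (v - p)].

Definition proj_on (V : {vspace 'rV[R]_n}) v : 'rV[R]_n :=
  orthogonal_projection [set u | u \in V] v.

Definition proj_perp (V : {vspace 'rV[R]_n}) v : 'rV[R]_n :=
  orthogonal_projection (orthogonal_set [set u | u \in V]) v.

End Euclidean.

(** * Filtrations, progressive processes and random fields

    Time and space variables range over the whole of [R]; only the values
    at times [0 <= t] and points [0 < x] are ever constrained. *)

Section Filtration.
Context {R : realType} {d : measure_display} {Omega : measurableType d}.
Variables (F : R -> set (set Omega)) (P : probability Omega R).

Definition filtration :=
  [/\ forall t, 0 <= t -> sigma_algebra setT (F t),
      forall t, 0 <= t -> F t `<=` measurable &
      forall s t, 0 <= s -> s <= t -> F s `<=` F t].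

Definition right_continuous_filtration :=
  forall t, 0 <= t -> F t = \bigcap_(s in `]t, +oo[) F s.

Definition complete_filtration :=
  forall t, 0 <= t -> forall A, P.-negligible A -> F t A.

Definition trivial_at_0 := forall A, F 0 A -> (P A = 0 \/ P A = 1)%E.

(* Measurability is for the Borel sigma-algebra of [V], hence is tested on
   open sets; this covers both [V = R] and [V = 'rV[R]_n]. *)
Definition adapted (V : topologicalType) (X : R -> Omega -> V) :=
  forall t, 0 <= t -> forall B : set V, open B -> F t (X t @^-1` B).

(* For each [t], the map [(s, w) |-> X s w] on [[0, t] * Omega] is measurable
   for the product of the Borel sigma-algebra and [F t]. *)
Definition progressive (V : topologicalType) (X : R -> Omega -> V) :=
  forall t, 0 <= t -> forall B : set V, open B ->
    <<s [set A `*` C | A in (@measurable _ R) & C in F t] >>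
      [set p : R * Omega | 0 <= p.1 <= t /\ B (X p.1 p.2)].

Definition progressive_field (V : topologicalType)
    (phi : R -> R -> Omega -> V) :=
  (forall B : set V, open B ->
    measurable [set p : R * R * Omega |
      [/\ 0 <= p.1.1, 0 < p.1.2 & B (phi p.1.1 p.1.2 p.2)]]) /\
  (forall x, 0 < x -> progressive (fun t => phi t x)).

(* The product formula says at once that [W t - W s] is independent of [F s],
   that its coordinates are independent, and that each of them has law
   N(0, t - s); the second parameter of [normal_prob] is the standard
   deviation. *)
Definition brownian_motion (n : nat) (W : R -> Omega -> 'rV[R]_n) :=
  [/\ adapted W,
      {ae P, forall w, W 0 w = 0},
      {ae P, forall w, {within `[0, +oo[, continuous (fun t => W t w)}} &
      forall s t, 0 <= s -> s < t ->
      forall (A : set Omega) (B : 'I_n -> set R),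
        F s A -> (forall i, measurable (B i)) ->
        P (A `&` [set w | forall i, B i ((W t w - W s w) ord0 i)]) =
        (P A * \prod_(i < n) normal_prob 0 (Num.sqrt (t - s)) (B i))%E].

End Filtration.

(** * The Ito integral, as the limit in probability, uniformly on compact time
    intervals, of the integrals of simple processes *)

Section Ito.
Context {R : realType} {d : measure_display} {Omega : measurableType d}.
Variables (F : R -> set (set Omega)) (P : probability Omega R).
Context {n : nat}.
Variable W : R -> Omega -> 'rV[R]_n.

(* The process equal to [sp_val i] on [(sp_time i, sp_time i.+1]] for
   [i < sp_len], and to 0 elsewhere. *)
Record simple_process := SimpleProcess {
  sp_len : nat;
  sp_time : nat -> R;
  sp_val : nat -> Omega -> 'rV[R]_n }.

Definition is_simple (S : simple_process) :=
  [/\ 0 <= sp_time S 0%N,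
      (forall i, sp_time S i <= sp_time S i.+1),
      (forall i (B : set 'rV[R]_n), (i < sp_len S)%N -> open B ->
        F (sp_time S i) (sp_val S i @^-1` B)) &
      exists C : R,
        forall i w, (i < sp_len S)%N -> enorm (sp_val S i w) <= C].

Definition simple_eval (S : simple_process) (t : R) (w : Omega) : 'rV[R]_n :=
  \sum_(i < sp_len S)
    (if sp_time S i < t <= sp_time S i.+1 then sp_val S i w else 0).

Definition simple_integral (S : simple_process) (t : R) (w : Omega) : R :=
  \sum_(i < sp_len S)
    dot (sp_val S i w)
        (W (Num.min t (sp_time S i.+1)) w - W (Num.min t (sp_time S i)) w).

(* [M] is (a continuous version of) the process [t |-> \int_0^t H_s . dW_s].
   The integrand need only be indistinguishable from a progressive process. *)
Definition ito_integral (H : R -> Omega -> 'rV[R]_n) (M : R -> Omega -> R) :=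
  [/\ exists H' : R -> Omega -> 'rV[R]_n,
        progressive F H' /\
        {ae P, forall w, forall t, 0 <= t -> H t w = H' t w},
      forall T, 0 < T ->
        {ae P, forall w, (\int[lebesgue_measure]_(s in `[0%R, T])
                            (enorm (H s w) ^+ 2)%:E < +oo)%E},
      adapted F M,
      {ae P, forall w, {within `[0, +oo[, continuous (fun t => M t w)}} &
      exists S : nat -> simple_process,
        (forall k, is_simple (S k)) /\
        forall T eps : R, 0 < T -> 0 < eps ->
          P [set w | (eps%:E < \int[lebesgue_measure]_(s in `[0%R, T])
                (enorm (simple_eval (S k) s w - H s w) ^+ 2)%:E)%E]
            @[k --> \oo] --> 0%E /\
          P [set w | exists2 t, 0 <= t <= T &
                eps < `|simple_integral (S k) t w - M t w|]
            @[k --> \oo] --> 0%E].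

(* [G(t,x) = G(0,x) + \int_0^t phi(s,x) ds + \int_0^t psi(s,x) . dW_s] *)
Definition ito_field (G phi : R -> R -> Omega -> R)
    (psi : R -> R -> Omega -> 'rV[R]_n) :=
  forall x, 0 < x ->
    {ae P, forall w, forall T, 0 < T ->
       lebesgue_measure.-integrable `[0, T] (fun s => (phi s x w)%:E)} /\
    exists M : R -> Omega -> R,
      ito_integral (fun t => psi t x) M /\
      {ae P, forall w, forall t, 0 <= t ->
         G t x w = G 0 x w
           + \int[lebesgue_measure]_(s in `[0, t]) phi s x w + M t w}.

End Ito.

(** * Regularity in the space variable on the half line *)

Section Regularity.
Context {R : realType} {V : normedModType R}.
Variable N : V -> R. (* the norm of [V] that is meant *)

Definition class_C (m : nat) (f : R -> V) :=
  (forall j x, (j < m)%N -> 0 < x -> derivable (derive1n j f) x 1) /\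
  (forall x, 0 < x -> {for x, continuous (derive1n m f)}).

Definition class_C_holder (m : nat) (delta : R) (f : R -> V) :=
  class_C m f /\
  forall K : set R, compact K -> K `<=` `]0, +oo[ ->
    exists C : R, forall x y, K x -> K y ->
      N (derive1n m f x - derive1n m f y) <= C * `|x - y| `^ delta.

(* Supremum of a set of nonnegative numbers, with the convention sup 0 = 0. *)
Definition sup_nonneg (A : set \bar R) : \bar R := ereal_sup (0%E |` A).

Definition seminorm (m : nat) (delta : R) (K : set R) (f : R -> V) : \bar R :=
  (sup_nonneg [set (N (f x) / x)%:E | x in K]
   + \sum_(1 <= j < m.+1) sup_nonneg [set (N (derive1n j f x))%:E | x in K]
   + sup_nonneg [set (N (derive1n m f p.1 - derive1n m f p.2)
                        / (`|p.1 - p.2| `^ delta))%:E |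
                 p in [set p : R * R | [/\ K p.1, K p.2 & p.1 != p.2]]])%E.

Context {d : measure_display} {Omega : measurableType d}.
Variables (F : R -> set (set Omega)) (P : probability Omega R).

Definition class_K_pow (q m : nat) (delta : R) (phi : R -> R -> Omega -> V) :=
  [/\ progressive_field F phi,
      {ae P, forall w, forall t, 0 <= t ->
         class_C_holder m delta (phi t ^~ w)} &
      forall (K : set R) (T : R), compact K -> K `<=` `]0, +oo[ -> 0 < T ->
        {ae P, forall w,
          (\int[lebesgue_measure]_(t in `[0%R, T])
             (seminorm m delta K (phi t ^~ w) ^+ q) < +oo)%E}].

Definition class_K := class_K_pow 1.
Definition class_K_bar := class_K_pow 2.

End Regularity.

(* [G] is a K^{m,delta}_loc-regular Ito random field with local
   characteristics [(phi, psi)]. *)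
Definition K_regular {R : realType} {d : measure_display}
    {Omega : measurableType d} (F : R -> set (set Omega))
    (P : probability Omega R) {n : nat} (W : R -> Omega -> 'rV[R]_n)
    (m : nat) (delta : R) (G phi : R -> R -> Omega -> R)
    (psi : R -> R -> Omega -> 'rV[R]_n) :=
  [/\ ito_field F P W G phi psi,
      {ae P, forall w, class_C_holder Num.norm m delta (G 0 ^~ w)},
      class_K Num.norm F P m delta phi &
      class_K_bar enorm F P m delta psi].

(** * Progressive utilities *)

Section Utility.
Context {R : realType} {d : measure_display} {Omega : measurableType d}.
Variables (F : R -> set (set Omega)) (P : probability Omega R).

(* The spatial derivative G_x. *)
Definition dx (V : normedModType R) (G : R -> R -> Omega -> V) :
    R -> R -> Omega -> V :=
  fun t x w => derive1 (G t ^~ w) x.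

Definition continuous_field (w : Omega) (G : R -> R -> Omega -> R) :=
  {within [set p : R * R | 0 <= p.1 /\ 0 < p.2],
    continuous (fun p : R * R => G p.1 p.2 w)}.

Definition utility_function (u : R -> R) :=
  [/\ forall x, 0 < x -> 0 <= u x,
      forall x y, 0 < x -> x < y -> u x < u y,
      forall x y l, 0 < x -> x < y -> 0 < l < 1 ->
        l * u x + (1 - l) * u y < u (l * x + (1 - l) * y) &
      class_C 2 u] /\
  [/\ u x @[x --> 0^'+] --> 0,
      derive1 u x @[x --> 0^'+] --> +oo &
      derive1 u x @[x --> +oo] --> 0].

Definition progressive_utility (U : R -> R -> Omega -> R) :=
  progressive_field F U /\
  {ae P, forall w,
    (forall t, 0 <= t -> utility_function (U t ^~ w)) /\
    [/\ continuous_field w U, continuous_field w (dx U) &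
        continuous_field w (dx (dx U))]}.

End Utility.

Definition convex_conjugate {R : realType} (u : R -> R) (y : R) : R :=
  sup [set u x - x * y | x in `]0, +oo[].

(** * Optimal characteristics, at a fixed time and scenario

    [u] and [g] stand for the sections [U(t,.)] and [gamma(t,.)], while
    [V], [r] and [eta] stand for [R_t], [r_t] and [eta_t]. *)

Section Optimal.
Context {R : realType} {n : nat}.
Variables (u : R -> R) (g : R -> 'rV[R]_n).
Variables (V : {vspace 'rV[R]_n}) (r : R) (eta : 'rV[R]_n).

(* x kappa^*(x), which is also sigma^*(x) *)
Definition x_kappa (x : R) : 'rV[R]_n :=
  - (derive1n 2 u x)^-1 *:
    (derive1 u x *: proj_on V eta + proj_on V (derive1 g x)).

Definition mu_star (x : R) : R := r * x + dot (x_kappa x) (proj_on V eta).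

Definition sigma_star (x : R) : 'rV[R]_n := x_kappa x.

Definition mu_tilde (y : R) : R := - (r * y).

Definition sigma_tilde (y : R) : 'rV[R]_n :=
  - (y *: proj_on V eta)
  + proj_perp V (derive1 g (- derive1 (convex_conjugate u) y)).

Definition L_hat (f : R -> R) (x : R) : R :=
  2^-1 * derive1 (fun z => enorm (sigma_star z) ^+ 2 * derive1 f z) x
  - mu_star x * derive1 f x.

(* the [dW]- and [dt]-coefficients of the SPDE, at the function [f] *)
Definition spde_diffusion (f : R -> R) (x : R) : 'rV[R]_n :=
  sigma_tilde (f x) - derive1 f x *: sigma_star x.

Definition spde_drift (f : R -> R) (x : R) : R :=
  mu_tilde (f x) - derive1 f x * dot (sigma_star x) (derive1 sigma_tilde (f x))
  + L_hat f x.

Definition hjb_constraints (b : R -> R) (x : R) :=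
  derive1 g x = - (derive1n 2 u x *: sigma_star x)
                + sigma_tilde (derive1 u x) /\
  b x = - (derive1 u x * x * r)
        + 2^-1 * derive1n 2 u x * enorm (sigma_star x) ^+ 2.

End Optimal.

(* Main.v *)
Require Import Defs.
From HB Require Import structures.
From mathcomp Require Import all_boot all_order all_algebra.
From mathcomp Require Import all_classical all_reals all_analysis.
From mathcomp Require Import measurable_realfun ring lra.

Set Implicit Arguments.
Unset Strict Implicit.
Unset Printing Implicit Defensive.

Import Order.TTheory GRing.Theory Num.Theory.
Import numFieldNormedType.Exports.

Local Open Scope ring_scope.
Local Open Scope classical_set_scope.

(** The proof has a pathwise half and a probabilistic half.

    Pathwise, the coefficients of the equation are just [beta_x] and [gamma_x].
    For the diffusion coefficient this is the constraint on [gamma]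
    ([spde_diffusion_eq]). For the drift, the constraint on [beta] reads
    [|sigma^*|^2 U_xx = 2 (beta + r x U_x)]; the derivative of the right-hand side
    gives [beta_x] plus a multiple of [<sigma^*, sigma_tilde' + eta^R>], and this
    scalar product is zero since [sigma^*] lies in the space of admissible
    directions whereas [sigma_tilde + y eta^R] takes its values in the orthogonal
    complement ([spde_drift_eq]). Differentiability of [sigma_tilde] at [U_x] comes
    from the inverse function theorem, once the derivative of the convex conjugate
    at [U_x(x)] is known to be [- x] ([is_derive_convex_conjugate]).

    It remains to differentiate the decomposition of [U] in [x], that is, to show
    that [U_x] is an Ito random field with characteristics [(beta_x, gamma_x)]
    ([ito_field_dx]). The difference quotients of [U] and of the drift converge
    pathwise and locally uniformly in time, the former because [U_xx] is
    continuous, the latter because the seminorm bounds [beta_xx]. Therefore the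
    difference quotients of the stochastic integrals converge as well, and only
    their limit has to be identified. The quotients of the integrands converge to
    [gamma_x] in [L^2([0, T])] for almost every scenario, so the limit is an Ito
    integral of [gamma_x] by a closure property: if [H_k] has the integral [M_k],
    and [H_k] tends to [H] in [L^2([0, T])], [M_k] to [M] uniformly on [[0, T]],
    almost surely, then [M] is an integral of [H] ([ito_limit]).

    Since an Ito integral is by definition a limit in probability of integrals of
    simple processes, this closure property is a diagonal argument, and linearity
    of the integral reduces to the refinement of subdivisions ([ito_scaled_diff]).
    Both arguments estimate probabilities of events about suprema and time integrals,
    whose measurability follows from continuity of paths, joint measurability of
    progressive processes and completeness of the filtration. *)

(** * Euclidean algebra and orthogonal projections *)

Section EuclideanTheory.
Context {R : realType} {n : nat}.
Implicit Types u v w : 'rV[R]_n.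

Lemma dotC u v : dot u v = dot v u.
Proof. by apply: eq_bigr => i _; rewrite mulrC. Qed.

Lemma dotDl u v w : dot (u + v) w = dot u w + dot v w.
Proof. by rewrite -big_split; apply: eq_bigr => i _; rewrite !mxE mulrDl. Qed.

Lemma dotZl a u v : dot (a *: u) v = a * dot u v.
Proof. by rewrite /dot mulr_sumr; apply: eq_bigr => i _; rewrite !mxE mulrA. Qed.

Lemma dotDr u v w : dot u (v + w) = dot u v + dot u w.
Proof. by rewrite dotC dotDl dotC (dotC w). Qed.

Lemma dotZr a u v : dot u (a *: v) = a * dot u v.
Proof. by rewrite dotC dotZl dotC. Qed.

Lemma dotNl u v : dot (- u) v = - dot u v.
Proof. by rewrite -scaleN1r dotZl mulN1r. Qed.

Lemma dotNr u v : dot u (- v) = - dot u v.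
Proof. by rewrite dotC dotNl dotC. Qed.

Lemma dot0l v : dot 0 v = 0.
Proof. by rewrite /dot big1 // => i _; rewrite mxE mul0r. Qed.

Lemma dotvv_ge0 v : 0 <= dot v v.
Proof. by apply: sumr_ge0 => i _; rewrite -expr2 sqr_ge0. Qed.

Lemma dotvv_eq0 v : dot v v = 0 -> v = 0.
Proof.
move=> /eqP; rewrite psumr_eq0; last by move=> i _; rewrite -expr2 sqr_ge0.
move=> /allP v0; apply/rowP => i; rewrite mxE.
by have := v0 i (mem_index_enum i); rewrite /= mulf_eq0 orbb => /eqP.
Qed.

Lemma enorm_ge0 v : 0 <= enorm v.
Proof. exact: sqrtr_ge0. Qed.

Lemma enorm_sqr v : enorm v ^+ 2 = dot v v.
Proof. by rewrite sqr_sqrtr ?dotvv_ge0. Qed.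

Lemma entry_le_enorm v i : `|v ord0 i| <= enorm v.
Proof.
rewrite -(@ler_pXn2r _ 2) ?nnegrE ?enorm_ge0 ?normr_ge0 //.
rewrite enorm_sqr real_normK ?num_real // /dot (bigD1 i) //= -expr2 lerDl.
by apply: sumr_ge0 => j _; rewrite -expr2 sqr_ge0.
Qed.

Lemma enorm_le_entries (c : R) v :
  0 <= c -> (forall i, `|v ord0 i| <= c) -> enorm v ^+ 2 <= n%:R * c ^+ 2.
Proof.
move=> c0 vc; rewrite enorm_sqr mulr_natl -[in leRHS](card_ord n) -sumr_const.
apply: ler_sum => i _; rewrite -expr2 -real_normK ?num_real //.
by rewrite lerXn2r // nnegrE.
Qed.

Lemma enorm_sqrD_le u v :
  enorm (u + v) ^+ 2 <= 2 * enorm u ^+ 2 + 2 * enorm v ^+ 2.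
Proof.
rewrite !enorm_sqr /dot !mulr_sumr -big_split /=; apply: ler_sum => i _.
rewrite mxE -subr_ge0.
by rewrite [leRHS](_ : _ = (u ord0 i - v ord0 i) ^+ 2) ?sqr_ge0 //; ring.
Qed.

Lemma enorm_sqrZ a v : enorm (a *: v) ^+ 2 = a ^+ 2 * enorm v ^+ 2.
Proof. by rewrite !enorm_sqr dotZl dotZr mulrA expr2. Qed.

Lemma enormN v : enorm (- v) = enorm v.
Proof. by rewrite /enorm dotNl dotNr opprK. Qed.

End EuclideanTheory.

Section OrthogonalProjection.
Context {R : realType} {n : nat}.
Implicit Types (V : {vspace 'rV[R]_n}) (u v : 'rV[R]_n).

(** The basis vectors of [V], as the rows of a matrix [B], have an invertible
    Gram matrix [B B^T], and [v B^T (B B^T)^-1 B] is the projection of [v]. *)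
Lemma orthogonal_decomposition V :
  exists A : 'M[R]_n, forall v, v *m A \in V /\
    orthogonal_set [set u | u \in V] (v - v *m A).
Proof.
pose B : 'M[R]_(\dim V, n) := \matrix_i tnth (vbasis V) i.
have BE (c : 'rV[R]_(\dim V)) : c *m B = \sum_i c ord0 i *: (vbasis V)`_i.
  rewrite mulmx_sum_row; apply: eq_bigr => i _.
  by rewrite rowK (tnth_nth 0).
have BV (c : 'rV[R]_(\dim V)) : c *m B \in V.
  rewrite BE; apply: memv_suml => i _; apply: memvZ.
  by rewrite vbasis_mem // mem_nth // size_tuple.
have VB v : v \in V -> exists c, v = c *m B.
  move=> vV; exists (\row_i coord (vbasis V) i v).
  by rewrite BE [LHS](coord_vbasis vV); apply: eq_bigr => i _; rewrite mxE.
have dotE u v : dot u v = (u *m v^T) ord0 ord0.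
  by rewrite mxE; apply: eq_bigr => i _; rewrite mxE.
have Gfree : B *m B^T \in unitmx.
  rewrite -row_free_unit; apply: inj_row_free => c cG.
  have cB0 : c *m B = 0.
    apply: dotvv_eq0; rewrite dotE trmx_mul !mulmxA -(mulmxA c B) cG.
    by rewrite mul0mx mxE.
  have /freeP fr := basis_free (vbasisP V).
  apply/rowP => i; rewrite mxE; apply: (fr (fun i => c ord0 i)).
  by rewrite -BE.
exists (B^T *m invmx (B *m B^T) *m B) => v; split.
  by rewrite !mulmxA BV.
move=> _ /VB[c ->]; rewrite dotE trmx_mul mulmxA mulmxBl !mulmxA.
by rewrite -(mulmxA _ B B^T) mulmxKV // subrr mxE.
Qed.

Lemma proj_onP V v :
  proj_on V v \in V /\ orthogonal_set [set u | u \in V] (v - proj_on V v).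
Proof.
have [A /(_ v)[vA oA]] := orthogonal_decomposition V.
rewrite /proj_on /orthogonal_projection.
by case: xgetP => [p _ [pV po] //|/(_ (v *m A))]; case; split.
Qed.

Lemma proj_on_mem V v : proj_on V v \in V.
Proof. by case: (proj_onP V v). Qed.

Lemma proj_perp_orthogonal V u v : u \in V -> dot u (proj_perp V v) = 0.
Proof.
move=> uV; rewrite dotC /proj_perp /orthogonal_projection.
case: xgetP => [p _ [po _]|_]; [exact: po|exact: dot0l].
Qed.

Lemma proj_perp_matrix V : exists A : 'M[R]_n, forall v, proj_perp V v = v *m A.
Proof.
have [A AP] := orthogonal_decomposition V; exists (1%:M - A) => v.
have [vA oA] := AP v; rewrite mulmxBr mulmx1.
rewrite /proj_perp /orthogonal_projection; case: xgetP => [p _ [pO pOO]|].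
  apply/eqP; rewrite -subr_eq0; apply/eqP/dotvv_eq0.
  have o1 : orthogonal_set [set u | u \in V] (p - (v - v *m A)).
    by move=> u uV; rewrite dotDl dotNl pO // oA // subrr.
  have E : p - (v - v *m A) = v *m A - (v - p).
    by rewrite !opprB addrCA.
  rewrite -/(dot _ _) {1}E dotDl dotC (o1 _ vA) add0r dotNl dotC.
  by rewrite dotC pOO ?oppr0.
move=> /(_ (v - v *m A)); case; split=> // u uO.
by rewrite opprB addrC subrK dotC uO.
Qed.

End OrthogonalProjection.

(** * Concave functions and their conjugates *)

Section RealFunctions.
Context {R : realType}.
Implicit Types (f u : R -> R) (x y z : R).

Lemma derive1_is_derive f x : derivable f x 1 -> is_derive x 1 f (derive1 f x).
Proof. by move=> df; rewrite derive1E; apply: DeriveDef. Qed.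

Lemma is_derive_derive1 f x l : is_derive x 1 f l -> derivable f x 1 /\ derive1 f x = l.
Proof. by case=> df fl; rewrite derive1E. Qed.

Lemma derivable_for_continuous f x : derivable f x 1 -> {for x, continuous f}.
Proof. by move=> /derivable1_diffP/differentiable_continuous. Qed.

Lemma linear_approx_is_derive f x l :
  (forall e, 0 < e -> exists2 h0, 0 < h0 & forall h, `|h| < h0 ->
     `|f (h + x) - f x - l * h| <= e * `|h|) ->
  is_derive x 1 f l.
Proof.
move=> fl; have cv : h^-1 *: (f (h *: (1 : R) + x) - f x) @[h --> 0^'] --> l.
  apply/cvgrPdist_le => e e0; have [h0 h00 fh] := fl e e0.
  near=> h.
  have h_neq0 : h != 0 by near: h; exact: nbhs_dnbhs_neq.
  have hh0 : `|h| < h0.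
    near: h; exists h0 => // h /=; by rewrite sub0r normrN.
  have -> : h *: (1 : R) = h by rewrite /GRing.scale /= mulr1.
  rewrite distrC (_ : _ - l = h^-1 * (f (h + x) - f x - l * h)); last first.
    by rewrite /GRing.scale /=; field.
  rewrite normrM normfV ler_pdivrMl ?normr_gt0 // [leRHS]mulrC; exact: fh.
split; first by apply/cvg_ex; exists l.
exact: cvg_lim.
Unshelve. all: by end_near. Qed.

(** Comparing [u] at [x + l (z - x)] with its chord between [x] and [z] bounds the
    difference quotient from below by [u z - u x] for every [l]; let [l] tend to
    0. *)
Lemma tangent_above_of_concave u x z :
  (forall x y l, 0 < x -> x < y -> 0 < l < 1 ->
     l * u x + (1 - l) * u y < u (l * x + (1 - l) * y)) ->
  0 < x -> 0 < z -> derivable u x 1 -> u z <= u x + derive1 u x * (z - x).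
Proof.
move=> cu x0 z0 du.
have cu' l : 0 < l < 1 -> (1 - l) * u x + l * u z <= u (l * (z - x) + x).
  move=> /andP[l0 l1]; have [xz|zx|->] := ltgtP x z.
  - have := cu x z (1 - l) x0 xz; rewrite subr_gt0 l1 gtrBl l0 => /(_ isT)/ltW.
    by rewrite subKr (_ : _ * x + l * z = l * (z - x) + x) //; ring.
  - have := cu z x l z0 zx; rewrite l0 l1 => /(_ isT)/ltW.
    by rewrite addrC (_ : l * z + _ = l * (z - x) + x) //; ring.
  - by rewrite subrr mulr0 add0r -mulrDl subrK mul1r.
have cv : l^-1 *: (u (l *: (z - x) + x) - u x) @[l --> 0^'+] -->
    derive1 u x * (z - x).
  apply: cvg_dnbhs_at_right.
  have ddu : differentiable u x by apply/derivable1_diffP.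
  suff <- : 'D_(z - x) u x = derive1 u x * (z - x).
    exact: (diff_derivable ddu).
  rewrite derive1E !deriveE // -[in LHS](mulr1 (z - x)).
  by rewrite -[(z - x) * 1]/((z - x) *: (1 : R)) linearZ [RHS]mulrC.
rewrite -lerBlDl -(cvg_lim _ cv) //; apply: limr_ge.
  by apply/cvg_ex; eexists; exact: cv.
near=> l; have l0 : 0 < l by near: l; exact: nbhs_right_gt.
have l1 : l < 1 by near: l; exact: nbhs_right_lt.
rewrite /GRing.scale /= ler_pdivlMl // lerBrDr.
by apply: le_trans (cu' l _); rewrite ?l0 // le_eqVlt; apply/orP/or_introl/eqP; ring.
Unshelve. all: by end_near. Qed.

(** The tangents at [x] and at [y] both pass above the graph of [u] at the midpoint,
    which itself lies strictly above the chord; this gives the strict inequality. *)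
Lemma derive1_decreasing_of_concave u x y :
  (forall x y l, 0 < x -> x < y -> 0 < l < 1 ->
     l * u x + (1 - l) * u y < u (l * x + (1 - l) * y)) ->
  (forall x, 0 < x -> derivable u x 1) ->
  0 < x -> x < y -> derive1 u y < derive1 u x.
Proof.
move=> cu du x0 xy; have y0 := lt_trans x0 xy.
pose m := 2^-1 * x + (1 - 2^-1) * y.
have m0 : 0 < m by rewrite /m; lra.
have half : 0 < 2^-1 :> R /\ 2^-1 < 1 :> R by split; lra.
have := cu x y 2^-1 x0 xy; rewrite half.1 half.2 => /(_ isT); rewrite -/m => um.
have /= h1 := tangent_above_of_concave cu x0 m0 (du x x0).
have /= h2 := tangent_above_of_concave cu y0 m0 (du y y0).
have : (derive1 u x - derive1 u y) * (y - x) > 0.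
  by rewrite /m in h1 h2 um; nra.
by rewrite pmulr_lgt0 ?subr_gt0.
Qed.

(** At a slope [u'(x)] the supremum that defines the conjugate is attained at
    [x]. Comparing the values at two slopes [u'(x)] and [u'(x')] through each
    other's maximisers encloses the difference quotient of the conjugate
    between [- x] and [- x']. *)
Lemma is_derive_convex_conjugate u x :
  (forall x y l, 0 < x -> x < y -> 0 < l < 1 ->
     l * u x + (1 - l) * u y < u (l * x + (1 - l) * y)) ->
  (forall x, 0 < x -> derivable u x 1) ->
  (forall x, 0 < x -> {for x, continuous (derive1 u)}) ->
  0 < x -> is_derive (derive1 u x) 1 (convex_conjugate u) (- x).
Proof.
move=> cu du cdu x0.
have ub z z' : 0 < z -> 0 < z' -> u z' - z' * derive1 u z <= u z - z * derive1 u z.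
  by move=> z0 z'0; have := tangent_above_of_concave cu z0 z'0 (du z z0); lra.
have conjE z : 0 < z -> convex_conjugate u (derive1 u z) = u z - z * derive1 u z.
  move=> z0; apply/eqP; rewrite eq_le; apply/andP; split.
    apply: ge_sup.
      by exists (u z - z * derive1 u z), z => //=; rewrite in_itv /= z0.
    by move=> y /= [z']; rewrite in_itv /= andbT => z'0 <-; exact: ub.
  apply: ub_le_sup; last by exists z => //=; rewrite in_itv /= z0.
  exists (u z - z * derive1 u z) => y /= [z']; rewrite in_itv /= andbT => z'0 <-.
  exact: ub.
have conj_ge z z' : 0 < z -> 0 < z' ->
    u z' - z' * derive1 u z <= convex_conjugate u (derive1 u z).
  by move=> z0 z'0; rewrite conjE //; exact: ub.
apply: linear_approx_is_derive => e e0.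
(* Every slope close enough to [u'(x)] is attained at some [x'] within [e'] of
   [x], by strict monotonicity and the intermediate value theorem. *)
pose e' := Num.min (e / 2) (x / 2).
have e'0 : 0 < e' by rewrite lt_min !divr_gt0.
have e'e : e' < e by rewrite gt_min; apply/orP; left; lra.
have e'x : e' < x by rewrite gt_min; apply/orP; right; lra.
clearbody e'.
have xe0 : 0 < x - e' by rewrite subr_gt0.
have lt1 : derive1 u x < derive1 u (x - e').
  by apply: derive1_decreasing_of_concave => //; rewrite ltrBlDr ltrDl.
have lt2 : derive1 u (x + e') < derive1 u x.
  by apply: derive1_decreasing_of_concave => //; rewrite ltrDl.
exists (Num.min (derive1 u (x - e') - derive1 u x) (derive1 u x - derive1 u (x + e'))).
  by rewrite lt_min !subr_gt0 lt1.
move=> h; rewrite lt_min => /andP[h1 h2].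
have [x'] : exists2 x', x' \in `[x - e', x + e']%R & derive1 u x' = h + derive1 u x.
  apply: IVT; first by rewrite lerD2l; lra.
    apply: continuous_in_subspaceT => z; rewrite inE /= in_itv /= => /andP[z1 _].
    by apply: cdu; exact: lt_le_trans z1.
  have [l1 l2] : derive1 u (x + e') <= h + derive1 u x <= derive1 u (x - e')
      /\ derive1 u (x + e') <= derive1 u (x - e').
    move: (ler_norm h) (ler_norm (- h)); rewrite normrN => n1 n2.
    by clear -h1 h2 n1 n2; split; [apply/andP; split; lra | lra].
  by rewrite min_r // max_l.
rewrite in_itv /= => /andP[x'1 x'2] x'E.
have x'0 : 0 < x' by apply: lt_le_trans x'1.
rewrite -x'E.
have a1 := conj_ge x' x x'0 x0; have a2 := conj_ge x x' x0 x'0.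
have b1 := conjE x x0; have b2 := conjE x' x'0.
have hE : h = derive1 u x' - derive1 u x by rewrite x'E addrK.
have dx' : `|x' - x| <= e by rewrite ler_norml; apply/andP; split; clear -x'1 x'2 e'e; lra.
apply: (@le_trans _ _ (`|x' - x| * `|h|)); last by rewrite ler_wpM2r.
rewrite -normrM -[leRHS]normrN hE; move: a1 a2 b1 b2.
move: (convex_conjugate u (derive1 u x')) (convex_conjugate u (derive1 u x)).
move: (derive1 u x') (derive1 u x) (u x) (u x').
clear=> p' p v v' c' c a1 a2 b1 b2.
rewrite [leLHS]ger0_norm; last by lra.
by apply: le_trans (ler_norm _); lra.
Qed.

End RealFunctions.

(** * The HJB constraints at a fixed time and scenario *)

Section HJB.
Context {R : realType} {n : nat}.
Variables (u b : R -> R) (g : R -> 'rV[R]_n).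
Variables (V : {vspace 'rV[R]_n}) (r : R) (eta : 'rV[R]_n).
Hypotheses (hu : utility_function u) (hu3 : class_C 3 u).
Hypotheses (hb : class_C 2 b) (hg : class_C 2 g).
Hypothesis hjb : forall x, 0 < x -> hjb_constraints u g V r eta b x.

Let du x : 0 < x -> derivable u x 1.
Proof. exact: (hu3.1 0%N x). Qed.

Let d2u x : 0 < x -> derivable (derive1 u) x 1.
Proof. exact: (hu3.1 1%N x). Qed.

Lemma positive_near (x : R) : 0 < x -> \forall z \near x, 0 < z.
Proof. exact: lt_nbhsr. Qed.

Lemma utility_derive1_decreasing (x y : R) :
  0 < x -> x < y -> derive1 u y < derive1 u x.
Proof.
move=> x0 xy; case: hu => -[_ _ cu _] _.
exact: (derive1_decreasing_of_concave cu du x0 xy).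
Qed.

Lemma spde_diffusion_eq (x : R) :
  0 < x -> spde_diffusion u g V eta (derive1 u) x = derive1 g x.
Proof. by move=> /hjb[-> _]; rewrite /spde_diffusion addrC. Qed.

Let sigma_sqrE (x : R) : 0 < x ->
  enorm (sigma_star u g V eta x) ^+ 2 * derive1 (derive1 u) x
    = 2 * (b x + derive1 u x * x * r).
Proof.
move=> /hjb[_ ->]; rewrite -[derive1n 2 u x]/(derive1 (derive1 u) x).
by field.
Qed.

Let sigma_sqr_is_derive (x : R) : 0 < x ->
  is_derive x 1
    (fun z => enorm (sigma_star u g V eta z) ^+ 2 * derive1 (derive1 u) z)
    (2 * (derive1 b x + (derive1 (derive1 u) x * x + derive1 u x) * r)).
Proof.
move=> x0.
apply: (@near_eq_is_derive _ _ _ (fun z => 2 * (b z + derive1 u z * z * r))).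
  near=> z; rewrite sigma_sqrE //; near: z; exact: positive_near.
have hbx := derive1_is_derive (hb.1 0%N x isT x0).
have hux := derive1_is_derive (d2u x0).
apply: is_derive_eq; rewrite /GRing.scale /=; ring.
Unshelve. all: by end_near. Qed.

(** The constraint on [beta] exhibits [|sigma^*|^2 U_xx] as the function
    [2 (beta + r x U_x)], which is differentiable also where [U_xx] vanishes
    and [sigma^*] itself need not be. *)
Lemma derivable_sigma_sqr (x : R) : 0 < x ->
  derivable (fun z => enorm (sigma_star u g V eta z) ^+ 2
                      * derive1 (derive1 u) z) x 1.
Proof. by move=> /sigma_sqr_is_derive[]. Qed.

Let inverse_marginal (y : R) : R := - derive1 (convex_conjugate u) y.

Let inverse_marginalK (x : R) : 0 < x -> inverse_marginal (derive1 u x) = x.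
Proof.
move=> x0; case: hu => -[_ _ cu _] _; rewrite /inverse_marginal.
have [] := is_derive_derive1 (is_derive_convex_conjugate cu du
  (fun z z0 => derivable_for_continuous (d2u z0)) x0).
by move=> _ ->; rewrite opprK.
Qed.

(** The inverse function theorem applies where [U_xx] does not vanish. *)
Let derivable_gamma_inverse (x : R) : 0 < x -> derive1 (derive1 u) x != 0 ->
  derivable (fun y => derive1 g (inverse_marginal y)) (derive1 u x) 1.
Proof.
move=> x0 ux0.
have dinv : is_derive (derive1 u x) 1 inverse_marginal (derive1 (derive1 u) x)^-1.
  have cancel_near : {near x, cancel (derive1 u) inverse_marginal}.
    by near=> z; apply: inverse_marginalK; near: z; exact: positive_near.
  have cont_near : \forall z \near x, continuous_at z (derive1 u).
    near=> z; apply: derivable_for_continuous; apply: d2u.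
    by near: z; exact: positive_near.
  exact: (is_derive_inverse cancel_near cont_near (derive1_is_derive (d2u x0)) ux0).
apply/derivable1_diffP; apply: (@differentiable_comp _ _ _ _ inverse_marginal).
  by apply/derivable1_diffP; case: dinv.
by apply/derivable1_diffP; rewrite inverse_marginalK //; exact: (hg.1 1%N x).
Unshelve. all: by end_near. Qed.

Lemma derivable_mulmx (f : R -> 'rV[R]_n) (A : 'M[R]_n) (y : R) :
  derivable f y 1 -> derivable (fun z => f z *m A) y 1.
Proof.
move=> /derivable_mxP df; apply/derivable_mxP => i j.
rewrite (_ : (fun z => _) = \sum_(k < n) (A k j \*: (fun z => f z i k))); last first.
  rewrite fct_sumE; apply/funext => z; rewrite mxE.
  by apply: eq_bigr => k _; rewrite /GRing.scale /= mulrC.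
by apply: derivable_sum => k; apply: derivableZ; exact: df.
Qed.

Lemma derivable_sigma_tilde (x : R) : 0 < x -> derive1 (derive1 u) x != 0 ->
  derivable (sigma_tilde u g V eta) (derive1 u x) 1.
Proof.
move=> x0 ux0; have [A AE] := proj_perp_matrix V.
rewrite (_ : sigma_tilde u g V eta = fun y =>
    - (y *: proj_on V eta) + derive1 g (inverse_marginal y) *m A); last first.
  by apply/funext => y; rewrite /sigma_tilde AE.
apply: derivableD; last exact/derivable_mulmx/derivable_gamma_inverse.
apply: derivableN; apply/derivable_mxP => i j.
rewrite (_ : (fun z => _) = (proj_on V eta i j \*: id)); last first.
  by apply/funext => z; rewrite mxE /GRing.scale /= mulrC.
by apply: derivableZ; exact: derivable_id.
Qed.

Lemma derive1_dot (f : R -> 'rV[R]_n) (v : 'rV[R]_n) (y : R) :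
  derivable f y 1 -> derive1 (fun z => dot v (f z)) y = dot v (derive1 f y).
Proof.
move=> df; have /derivable_mxP dfi := df.
rewrite (_ : (fun z => _) = \sum_(i < n) (v ord0 i \*: (fun z => f z ord0 i))).
  rewrite !derive1E derive_mx // derive_sum; last first.
    by move=> i; apply: derivableZ; exact: dfi.
  by apply: eq_bigr => i _; rewrite deriveZ // mxE.
by rewrite fct_sumE.
Qed.

(** [sigma_tilde] is [- y eta^R] plus a function with values in the orthogonal
    complement of [V]; the derivative of that function stays there. *)
Lemma dot_derive_sigma_tilde (v : 'rV[R]_n) (x : R) :
  v \in V -> 0 < x -> derive1 (derive1 u) x != 0 ->
  dot v (derive1 (sigma_tilde u g V eta) (derive1 u x))
    = - dot v (proj_on V eta).
Proof.
move=> vV x0 ux0; rewrite -derive1_dot; last exact: derivable_sigma_tilde.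
rewrite (_ : (fun z => _) = (- dot v (proj_on V eta)) \*: (id : R -> R)).
  by rewrite derive1E deriveZ // derive_id /GRing.scale /= mulr1.
apply/funext => z; rewrite dotDr dotNr dotZr proj_perp_orthogonal // addr0.
by rewrite [RHS]mulNr mulrC.
Qed.

Lemma sigma_star_mem (x : R) : sigma_star u g V eta x \in V.
Proof.
by rewrite memvZ // memvD ?memvZ ?proj_on_mem.
Qed.

(** With [|sigma^*|^2 U_xx = 2 (beta + r x U_x)], the drift of the equation is
    [beta_x - U_xx <sigma^*, sigma_tilde' + eta^R>]. The scalar product vanishes
    because [sigma^*] lies in [V]; where [U_xx = 0] the whole term does. *)
Lemma spde_drift_eq (x : R) :
  0 < x -> spde_drift u g V r eta (derive1 u) x = derive1 b x.
Proof.
move=> x0; rewrite /spde_drift /L_hat /mu_tilde /mu_star.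
have [_ ->] := is_derive_derive1 (sigma_sqr_is_derive x0).
have [->|ux0] := eqVneq (derive1 (derive1 u) x) 0.
  by rewrite !(mul0r, mulr0, subr0, add0r); field.
rewrite (dot_derive_sigma_tilde (sigma_star_mem x) x0 ux0) /sigma_star.
by field.
Qed.

End HJB.

(** * Borel measurability tested on open sets *)

Section SetFamilies.
Context {T : Type} (G : set (set T)).
Hypothesis sG : sigma_algebra setT G.

Lemma sigmaT : G setT.
Proof. by case: sG => G0 GC _; rewrite -(setD0 setT); exact: GC. Qed.

Lemma sigmaC A : G A -> G (~` A).
Proof. by case: sG => _ GC _ /GC; rewrite setTD. Qed.

Lemma sigma_bigcup A : (forall k : nat, G (A k)) -> G (\bigcup_k A k).
Proof. by move=> GA; case: sG => _ _; apply. Qed.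

Lemma sigma_bigcap A : (forall k : nat, G (A k)) -> G (\bigcap_k A k).
Proof.
by move=> GA; rewrite -(setCK (\bigcap_k _)) setC_bigcap; apply/sigmaC/sigma_bigcup
  => k; exact: sigmaC.
Qed.

Lemma sigmaU A B : G A -> G B -> G (A `|` B).
Proof.
move=> GA GB; rewrite -bigcup2E; apply: sigma_bigcup => -[|[|k]] /=; [exact: GA|exact: GB|].
by case: sG.
Qed.

Lemma sigmaI A B : G A -> G B -> G (A `&` B).
Proof.
by move=> GA GB; rewrite -(setCK (A `&` B)) setCI; apply/sigmaC/sigmaU; exact: sigmaC.
Qed.

Lemma sigma_bigcup_count (I : countType) (A : I -> set T) :
  (forall i, G (A i)) -> G (\bigcup_i A i).
Proof.
move=> GA; rewrite (_ : \bigcup_i A i =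
    \bigcup_k (if unpickle k is Some i then A i else set0)).
  apply: sigma_bigcup => k; case: unpickle => [i|]; [exact: GA|by case: sG].
apply/seteqP; split=> [x [i _ Aix]|x [k _]].
  by exists (pickle i) => //; rewrite pickleK.
by case: unpickle => [i Aix|//]; exists i.
Qed.

End SetFamilies.

(** Borel measurability of [f] on [D], relatively to an arbitrary family [G] of
    sets: adaptedness, progressivity and joint measurability are all instances
    of it. *)
Definition meas_on {T : Type} (G : set (set T)) (D : set T)
    {V : topologicalType} (f : T -> V) :=
  forall B : set V, open B -> G (D `&` f @^-1` B).

Section MeasOn.
Context {R : realType} {T : Type} (G : set (set T)) (D : set T).
Hypothesis sG : sigma_algebra setT G.

Lemma meas_on_dom {V : topologicalType} (f : T -> V) : meas_on G D f -> G D.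
Proof. by move=> /(_ _ openT); rewrite preimage_setT setIT. Qed.

Lemma meas_on_cst {V : topologicalType} (v : V) : G D -> meas_on G D (fun=> v).
Proof.
move=> GD B _; rewrite preimage_cst; case: ifP => _; first by rewrite setIT.
by rewrite setI0; case: sG.
Qed.

Lemma meas_on_comp {V V' : topologicalType} (f : T -> V) (phi : V -> V') :
  continuous phi -> meas_on G D f -> meas_on G D (phi \o f).
Proof.
by move=> cphi mf B oB; rewrite comp_preimage; apply: mf; exact: open_comp.
Qed.

Lemma meas_on_if {V : topologicalType} (A : T -> bool) (f g : T -> V) :
  G (D `&` [set x | A x]) -> meas_on G D f -> meas_on G D g ->
  meas_on G D (fun x => if A x then f x else g x).
Proof.
move=> GA mf mg B oB; rewrite (_ : _ `&` _ =
    (D `&` [set x | A x]) `&` (D `&` f @^-1` B) `|`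
    (~` (D `&` [set x | A x])) `&` (D `&` g @^-1` B)).
  by apply: sigmaU => //; apply: sigmaI => //;
    [exact: mf|exact: sigmaC|exact: mg].
apply/seteqP; split=> x /=.
  by case: (boolP (A x)) => Ax [Dx Bx]; [left|right; split=> // -[]].
case=> [[[Dx ->] [_ //]]|[nA [Dx Bx]]]; split=> //.
by case: ifP => // Ax; case: nA.
Qed.

Lemma invr_succ_gt0 (m : nat) : 0 < m.+1%:R^-1 :> R.
Proof. by rewrite invr_gt0. Qed.

Lemma invr_succ_lt (e : R) : 0 < e -> exists m, m.+1%:R^-1 < e.
Proof. by move=> /ltr_add_invr[m]; rewrite add0r => me; exists m. Qed.

(** A limit lies in the open set [B] iff the sequence eventually lies, for some
    [m], among the points whose distance to the complement of [B] exceeds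
    [1 / (m + 1)]; those points form an open set. *)
Lemma meas_on_lim {V : normedModType R} (f : nat -> T -> V) (g : T -> V) :
  (forall k, meas_on G D (f k)) ->
  (forall x, D x -> f k x @[k --> \oo] --> g x) -> meas_on G D g.
Proof.
move=> mf fg B oB.
pose Bm (m : nat) : set V :=
  [set v | exists2 e : R, m.+1%:R^-1 < e & ball v e `<=` B].
have oBm m : open (Bm m).
  rewrite openE => v [e me vB]; rewrite /interior -nbhs_ballE.
  have [c mc ce] : exists2 c : R, m.+1%:R^-1 < c & c < e.
    by exists ((m.+1%:R^-1 + e) / 2); [case/midf_lt: me|case/midf_lt: me].
  exists (e - c) => /=; first by rewrite subr_gt0.
  move=> v' vv'; exists c => // z vz; apply: vB.
  by rewrite -(subrK c e); exact: ball_triangle vv' vz.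
rewrite (_ : _ `&` _ = \bigcup_m \bigcup_N \bigcap_k
    (if (N <= k)%N then D `&` f k @^-1` Bm m else D)).
  do 2 (apply: sigma_bigcup => // ?); apply: sigma_bigcap => // k.
  by case: ifP => _; [exact: mf|exact: meas_on_dom (mf 0%N)].
apply/seteqP; split=> x.
  move=> [Dx Bx]; have : nbhs (g x) B by apply: open_nbhs_nbhs.
  rewrite -nbhs_ballE => -[e /= e0 eB].
  have e20 : 0 < e / 2 by rewrite divr_gt0.
  have [m me] := invr_succ_lt e20.
  have /cvgrPdist_lt/(_ _ e20)[N _ NP] := fg x Dx.
  exists m => //; exists N => // k _; case: ifP => // Nk; split=> //.
  exists (e / 2) => // z; rewrite -ball_normE /= => zf; apply: eB.
  rewrite -ball_normE /= (le_lt_trans (ler_distD (f k x) _ _)) //.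
  rewrite [ltRHS]splitr ltrD //; first exact: NP.
case=> m _ [N _ H]; have Dx : D x.
  by have := H N I; rewrite leqnn => -[].
split=> //=.
have /cvgrPdist_lt/(_ _ (invr_succ_gt0 m))[N' _ N'P] := fg x Dx.
have := H (maxn N N') I; rewrite leq_maxl => -[_ [e me]]; apply.
have /= := N'P (maxn N N') (leq_maxr _ _).
by rewrite -ball_normE /= distrC => h; exact: lt_trans me.
Qed.

Definition dense_seq (V : normedModType R) (q : nat -> V) :=
  forall x e, 0 < e -> exists k, ball (q k) e x.

(** The preimage of an open set under [phi] is a countable union of products of
    balls centred in the dense sequences. *)
Lemma meas_on_comp2 {V1 V2 : normedModType R} {V' : topologicalType}
    (q1 : nat -> V1) (q2 : nat -> V2) (f : T -> V1) (g : T -> V2)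
    (phi : V1 * V2 -> V') :
  dense_seq q1 -> dense_seq q2 -> continuous phi ->
  meas_on G D f -> meas_on G D g -> meas_on G D (fun x => phi (f x, g x)).
Proof.
move=> dq1 dq2 cphi mf mg B oB.
pose b1 (p : nat * nat * nat) := ball (q1 p.1.1) (p.2.+1%:R^-1 : R).
pose b2 (p : nat * nat * nat) := ball (q2 p.1.2) (p.2.+1%:R^-1 : R).
rewrite (_ : _ `&` _ = \bigcup_p
   (if `[< forall u v, b1 p u -> b2 p v -> B (phi (u, v)) >]
    then (D `&` f @^-1` b1 p) `&` (D `&` g @^-1` b2 p) else set0)).
  apply: sigma_bigcup_count => // p; case: ifP => _; last by case: sG.
  by apply: sigmaI => //; [apply: mf|apply: mg]; exact: ball_open.
apply/seteqP; split=> x.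
  move=> [Dx /= Bx].
  have : nbhs (f x, g x) (phi @^-1` B) by apply: cphi; exact: open_nbhs_nbhs.
  case=> -[A1 A2] /= [nA1 nA2] A12.
  move: nA1 nA2; rewrite -!nbhs_ballE => -[e1 /= e10 A1e] [e2 /= e20 A2e].
  pose e := Num.min e1 e2.
  have e0 : 0 < e by rewrite lt_min e10.
  have e20' : 0 < e / 2 by rewrite divr_gt0.
  have [m me] := invr_succ_lt e20'.
  have m0 := invr_succ_gt0 m.
  have [i fi] := dq1 (f x) _ m0; have [j gj] := dq2 (g x) _ m0.
  exists (i, j, m) => //; case: asboolP => [_|]; first by split.
  case=> u v uf vg; apply: (A12 (u, v)); split=> /=.
    apply: A1e; apply: (@le_ball _ _ _ (m.+1%:R^-1 + m.+1%:R^-1)).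
      by apply: (@le_trans _ _ e); [rewrite [leRHS]splitr lerD // ltW|rewrite ge_min lexx].
    by apply: ball_triangle uf; exact: ball_sym.
  apply: A2e; apply: (@le_ball _ _ _ (m.+1%:R^-1 + m.+1%:R^-1)).
    by apply: (@le_trans _ _ e); [rewrite [leRHS]splitr lerD // ltW|rewrite ge_min lexx orbT].
  by apply: ball_triangle vg; exact: ball_sym.
by case=> p _; case: asboolP => // BP [[Dx fx] [_ gx]]; split=> //; exact: BP.
Qed.

End MeasOn.

Lemma dense_seq_R (R : realType) : exists q : nat -> R, dense_seq q.
Proof.
exists (fun k => ratr (odflt 0 (unpickle k))) => x e e0.
have [q /andP[q1 q2]] : exists q : rat, x - e < ratr q < x + e.
  have xe : x - e < x + e by lra.
  by have [q] := rat_in_itvoo xe; rewrite in_itv; exists q.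
exists (pickle q); rewrite pickleK /= -ball_normE /= ltr_norml.
by apply/andP; split; lra.
Qed.

Lemma dense_seq_rV (R : realType) (n : nat) : exists q : nat -> 'rV[R]_n, dense_seq q.
Proof.
have [q dq] := dense_seq_R R.
exists (fun k => \row_i
  q (odflt [ffun=> 0%N] (unpickle k : option {ffun 'I_n -> nat}) i)).
move=> x e e0.
have [f fP] : exists f : {ffun 'I_n -> nat}, forall i, ball (q (f i)) e (x ord0 i).
  have /choice[f fP] : forall i : 'I_n, exists k, ball (q k) e (x ord0 i).
    by move=> i; exact: dq.
  by exists (finfun f) => i; rewrite ffunE.
by exists (pickle f); rewrite pickleK; split=> // i j; rewrite mxE ord1; exact: fP.
Qed.

Section MeasOnVectors.
Context {R : realType} {n : nat} {T : Type} (G : set (set T)) (D : set T).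
Hypothesis sG : sigma_algebra setT G.
Implicit Types f g : T -> 'rV[R]_n.

Lemma continuous_dot : continuous (fun p : 'rV[R]_n * 'rV[R]_n => dot p.1 p.2).
Proof.
apply: continuous_big => [|i _ [u v]]; first exact: add_continuous.
have ci : continuous (fun v : 'rV[R]_n => v ord0 i) by exact: coord_continuous.
have c1 : (fun p : 'rV[R]_n * 'rV[R]_n => p.1 ord0 i) @ (u, v) --> u ord0 i.
  by move=> A /(ci u)/(@cvg_fst _ _ (nbhs u) (nbhs v) _).
have c2 : (fun p : 'rV[R]_n * 'rV[R]_n => p.2 ord0 i) @ (u, v) --> v ord0 i.
  by move=> A /(ci v)/(@cvg_snd _ _ (nbhs u) (nbhs v) _).
exact: (cvgM c1 c2).
Qed.

Lemma meas_on_rV2 {V' : topologicalType} (phi : 'rV[R]_n * 'rV[R]_n -> V') f g :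
  continuous phi ->
  meas_on G D f -> meas_on G D g -> meas_on G D (fun x => phi (f x, g x)).
Proof.
have [q qd] := dense_seq_rV R n => cphi mf mg.
exact (meas_on_comp2 sG qd qd cphi mf mg).
Qed.

Lemma meas_on_add f g :
  meas_on G D f -> meas_on G D g -> meas_on G D (fun x => f x + g x).
Proof.
move=> mf mg.
have cD : continuous (fun p : 'rV[R]_n * 'rV[R]_n => p.1 + p.2) by exact: add_continuous.
exact (meas_on_rV2 cD mf mg).
Qed.

Lemma meas_on_scale (c : R) f : meas_on G D f -> meas_on G D (fun x => c *: f x).
Proof. by move=> mf; exact (meas_on_comp (@scaler_continuous _ _ c) mf). Qed.

Lemma meas_on_sub f g :
  meas_on G D f -> meas_on G D g -> meas_on G D (fun x => f x - g x).
Proof.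
move=> mf mg; under eq_fun do rewrite -scaleN1r.
exact (meas_on_add mf (meas_on_scale (-1) mg)).
Qed.

Lemma meas_on_sum (I : Type) (s : seq I) (f : I -> T -> 'rV[R]_n) :
  G D -> (forall i, meas_on G D (f i)) ->
  meas_on G D (fun x => \sum_(i <- s) f i x).
Proof.
move=> GD mf; elim: s => [|i s ih].
  by under eq_fun do rewrite big_nil; exact (meas_on_cst sG _ GD).
by under eq_fun do rewrite big_cons; exact (meas_on_add (mf i) ih).
Qed.

Lemma meas_on_dot f g :
  meas_on G D f -> meas_on G D g -> meas_on G D (fun x => dot (f x) (g x)).
Proof. by move=> mf mg; exact (meas_on_rV2 continuous_dot mf mg). Qed.

Lemma meas_on_enorm_sqr f :
  meas_on G D f -> meas_on G D (fun x => enorm (f x) ^+ 2).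
Proof.
by move=> mf; under eq_fun do rewrite enorm_sqr; exact (meas_on_dot mf mf).
Qed.

End MeasOnVectors.

Lemma meas_on_sumR {R : realType} {T : Type} (G : set (set T)) (D : set T)
    (I : Type) (s : seq I) (f : I -> T -> R) :
  sigma_algebra setT G -> G D -> (forall i, meas_on G D (f i)) ->
  meas_on G D (fun x => \sum_(i <- s) f i x).
Proof.
move=> sG GD mf; elim: s => [|i s ih].
  by under eq_fun do rewrite big_nil; exact (meas_on_cst sG _ GD).
under eq_fun do rewrite big_cons; have [q dq] := dense_seq_R R.
have cD : continuous (fun p : R * R => p.1 + p.2) by exact: add_continuous.
exact (meas_on_comp2 sG dq dq cD (mf i) ih).
Qed.

Lemma meas_on_subR {R : realType} {T : Type} (G : set (set T)) (D : set T)
    (f g : T -> R) :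
  sigma_algebra setT G -> meas_on G D f -> meas_on G D g ->
  meas_on G D (fun x => f x - g x).
Proof.
move=> sG mf mg; have [q dq] := dense_seq_R R.
have cD : continuous (fun p : R * R => p.1 - p.2) by exact: sub_continuous.
exact (meas_on_comp2 sG dq dq cD mf mg).
Qed.

Section MeasOnMeasurable.
Context {R : realType} {d : measure_display} {T : measurableType d}.

Lemma sigma_algebra_measurable_sets : sigma_algebra setT (@measurable d T).
Proof.
split=> [//|A mA|A mA]; first by rewrite setTD; exact: measurableC.
exact: bigcup_measurable.
Qed.

Lemma meas_on_measurable_fun (D : set T) (f : T -> R) :
  meas_on measurable D f -> measurable_fun D f.
Proof.
move=> mf; apply: (measurability _ (RGenOpens.measurableE R)).
by move=> _ [_ [a [b ->] <-]]; apply: mf; exact: interval_open.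
Qed.

End MeasOnMeasurable.

(** * Linear combinations of simple processes *)

Section Refinement.
Context {R : realType}.

(** The terms retained by the indicator are those with index in [[a, b)], up to
    repeated values of [tau], whose increments vanish. *)
Lemma telescope_indicator (Z : zmodType) (tau : nat -> R) (f : R -> Z)
    (N a b : nat) :
  {homo tau : i j / (i <= j)%N >-> i <= j} -> (a <= N)%N -> (b <= N)%N ->
  tau a <= tau b ->
  f (tau b) - f (tau a) =
  \sum_(j < N) (if tau a < tau j.+1 <= tau b then f (tau j.+1) - f (tau j) else 0).
Proof.
move=> mtau; wlog ab : a / (a <= b)%N => [hw aN bN tab|aN bN _].
  have [ab|/ltnW ba] := leqP a b; first exact: hw.
  have tE : tau a = tau b by apply/eqP; rewrite eq_le tab mtau.
  by rewrite !tE; exact: hw.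
rewrite -(telescope_sumr (f \o tau) ab) /=.
rewrite -[RHS](big_mkord xpredT (fun j => if tau a < tau j.+1 <= tau b
  then f (tau j.+1) - f (tau j) else 0)).
rewrite (@big_cat_nat _ _ _ a 0%N N) //= (@big_cat_nat _ _ _ b a N) //=.
rewrite [X in _ = X + _]big1_seq ?add0r; last first.
  move=> j /andP[_]; rewrite mem_index_iota => /andP[_ ja].
  by rewrite ltNge (mtau _ _ ja).
rewrite [X in _ + X]big1_seq ?addr0; last first.
  move=> j /andP[_]; rewrite mem_index_iota => /andP[bj _].
  case: ifP => // /andP[_ jb]; rewrite (_ : tau j.+1 = tau j) ?subrr //.
  apply/eqP; rewrite eq_le (mtau j j.+1) // andbT.
  by apply: le_trans jb _; exact: mtau.
apply: eq_big_nat => j /andP[aj jb].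
have -> : tau j.+1 <= tau b by exact: mtau.
rewrite andbT; case: ltP => // ja.
rewrite (_ : tau j.+1 = tau j) ?subrr //; apply/eqP.
rewrite eq_le (mtau j j.+1) // andbT.
by apply: le_trans ja _; exact: mtau.
Qed.

(** Both the value and the integral of a simple process are sums of terms
    [B (val_i) (f t_(i+1) - f t_i)], with [B] biadditive; such a sum is unchanged
    when the subdivision is refined. *)
Lemma simple_sum_refine {d : measure_display} {Omega : measurableType d} {n : nat}
    (S : simple_process (R := R) (Omega := Omega) (n := n))
    (Z Z' : zmodType) (B : 'rV[R]_n -> Z -> Z') (f : R -> Z)
    (tau : nat -> R) (N : nat) (w : Omega) :
  (forall x, B 0 x = 0) -> (forall u v x, B (u + v) x = B u x + B v x) ->
  (forall v, B v 0 = 0) -> (forall v x y, B v (x + y) = B v x + B v y) ->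
  {homo tau : i j / (i <= j)%N >-> i <= j} ->
  (forall i, sp_time S i <= sp_time S i.+1) ->
  (forall i, (i <= sp_len S)%N -> exists2 a, (a <= N)%N & sp_time S i = tau a) ->
  \sum_(i < sp_len S) B (sp_val S i w) (f (sp_time S i.+1) - f (sp_time S i)) =
  \sum_(j < N) B (simple_eval S (tau j.+1) w) (f (tau j.+1) - f (tau j)).
Proof.
move=> B0l BDl B0r BDr mtau tS StN; transitivity (\sum_(i < sp_len S) \sum_(j < N)
  (if sp_time S i < tau j.+1 <= sp_time S i.+1
   then B (sp_val S i w) (f (tau j.+1) - f (tau j)) else 0)).
  apply: eq_bigr => i _.
  have [a aN aE] := StN i (ltnW (ltn_ord i)).
  have [b bN bE] := StN i.+1 (ltn_ord i).
  rewrite {1}aE {1}bE (telescope_indicator _ mtau aN bN) -?aE -?bE //.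
  rewrite (big_morph (B (sp_val S i w)) (BDr _) (B0r _)).
  by apply: eq_bigr => j _; case: ifP.
rewrite exchange_big; apply: eq_bigr => j _.
rewrite /simple_eval (big_morph (B ^~ _) (fun u v => BDl u v _) (B0l _)).
by apply: eq_bigr => i _; case: ifP.
Qed.

End Refinement.

Section SimpleLinear.
Context {R : realType} {d : measure_display} {Omega : measurableType d}.
Variable F : R -> set (set Omega).
Context {n : nat}.
Variable W : R -> Omega -> 'rV[R]_n.
Implicit Types S : simple_process (R := R) (Omega := Omega) (n := n).

Definition simple_times S := [seq sp_time S i | i <- iota 0 (sp_len S).+1].

Definition common_times S1 S2 := sort <=%R (simple_times S1 ++ simple_times S2).

(** The default value prolongs the subdivision by its last time, which makes the
    sequence nondecreasing on all indices. *)
Definition common_time S1 S2 j :=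
  nth (last 0 (common_times S1 S2)) (common_times S1 S2) j.

(** No time of [S1] or [S2] lies strictly inside an interval of the common
    subdivision, so that their values on it can be read off at its right end. *)
Definition simple_scaled_diff (c : R) S1 S2 : simple_process :=
  SimpleProcess (size (common_times S1 S2)).-1 (common_time S1 S2)
    (fun j w => c *: (simple_eval S1 (common_time S1 S2 j.+1) w
                      - simple_eval S2 (common_time S1 S2 j.+1) w)).

Lemma common_time_homo S1 S2 :
  {homo common_time S1 S2 : i j / (i <= j)%N >-> i <= j}.
Proof.
have st : sorted <=%R (common_times S1 S2) by apply: sort_sorted; exact: le_total.
rewrite /common_time; set L := common_times S1 S2 in st *.
have le_nth (x0 : R) a b : (a <= b)%N -> (b < size L)%N -> nth x0 L a <= nth x0 L b.
  move=> ab bL; apply: (sorted_leq_nth le_trans (@lexx _ _)) => //; rewrite inE //.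
  exact: leq_ltn_trans bL.
move=> i j ij; have [jL|Lj] := ltnP j (size L); first exact: le_nth.
rewrite [leRHS]nth_default //.
have [iL|Li] := ltnP i (size L); last by rewrite nth_default.
rewrite -(nth_last 0) (set_nth_default 0) // le_nth //.
  by rewrite -ltnS (ltn_predK iL).
by rewrite (ltn_predK iL).
Qed.

Lemma common_times_mem S1 S2 x :
  x \in common_times S1 S2 ->
  exists2 a, (a <= (size (common_times S1 S2)).-1)%N & x = common_time S1 S2 a.
Proof.
move=> xL; exists (index x (common_times S1 S2)).
  have iL : (index x (common_times S1 S2) < size (common_times S1 S2))%N.
    by rewrite index_mem.
  by rewrite -ltnS (ltn_predK iL).
by rewrite /common_time nth_index.
Qed.

Lemma simple_times_mem S i : (i <= sp_len S)%N -> sp_time S i \in simple_times S.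
Proof. by move=> iS; apply: map_f; rewrite mem_iota. Qed.

Lemma common_timesl S1 S2 i : (i <= sp_len S1)%N ->
  exists2 a, (a <= (size (common_times S1 S2)).-1)%N
           & sp_time S1 i = common_time S1 S2 a.
Proof.
by move=> /simple_times_mem iS; apply: common_times_mem; rewrite mem_sort mem_cat iS.
Qed.

Lemma common_timesr S1 S2 i : (i <= sp_len S2)%N ->
  exists2 a, (a <= (size (common_times S1 S2)).-1)%N
           & sp_time S2 i = common_time S1 S2 a.
Proof.
move=> /simple_times_mem iS; apply: common_times_mem.
by rewrite mem_sort mem_cat iS orbT.
Qed.

Lemma simple_time_homo S : (forall i, sp_time S i <= sp_time S i.+1) ->
  {homo sp_time S : i j / (i <= j)%N >-> i <= j}.
Proof. by move=> tS; apply: (homo_leq le_refl le_trans). Qed.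

(** The indicator of [(t_i, t_(i+1)]] is the increment of [s |-> - 1_(s < t)],
    which puts the value of a simple process in the form of
    [simple_sum_refine]. *)
Lemma simple_evalE S t w :
  (forall i, sp_time S i <= sp_time S i.+1) ->
  simple_eval S t w =
  \sum_(i < sp_len S) (- (sp_time S i.+1 < t)%R%:R - - (sp_time S i < t)%R%:R)
                      *: sp_val S i w.
Proof.
move=> tS; apply: eq_bigr => i _; rewrite opprK addrC [t <= _]leNgt.
have [it|ti] := boolP (sp_time S i.+1 < t).
  by rewrite (le_lt_trans (tS i) it) /= subrr scale0r.
by rewrite subr0 andbT; case: ifP => _; rewrite ?scale1r ?scale0r.
Qed.

Lemma simple_scaled_diff_eval c S1 S2 t w :
  is_simple F S1 -> is_simple F S2 ->
  simple_eval (simple_scaled_diff c S1 S2) t w =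
  c *: (simple_eval S1 t w - simple_eval S2 t w).
Proof.
move=> [_ t1 _ _] [_ t2 _ _]; have mt := @common_time_homo S1 S2.
rewrite simple_evalE; last by move=> i; exact: mt.
pose B (v : 'rV[R]_n) (x : R) := x *: v.
have refine S : (forall i, sp_time S i <= sp_time S i.+1) ->
    (forall i, (i <= sp_len S)%N -> exists2 a,
       (a <= (size (common_times S1 S2)).-1)%N & sp_time S i = common_time S1 S2 a) ->
    simple_eval S t w = \sum_(j < (size (common_times S1 S2)).-1)
      B (simple_eval S (common_time S1 S2 j.+1) w)
        (- (common_time S1 S2 j.+1 < t)%R%:R - - (common_time S1 S2 j < t)%R%:R).
  move=> tS StN; rewrite simple_evalE //.
  rewrite -(@simple_sum_refine _ _ _ _ S _ _ B (fun s => - (s < t)%R%:R)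
    (common_time S1 S2)) //.
  - by move=> x; rewrite /B scaler0.
  - by move=> u v x; rewrite /B scalerDr.
  - by move=> v; rewrite /B scale0r.
  - by move=> v x y; rewrite /B scalerDl.
rewrite (refine _ t1 (@common_timesl S1 S2)) (refine _ t2 (@common_timesr S1 S2)).
rewrite -sumrB scaler_sumr; apply: eq_bigr => j _ /=.
by rewrite /B -scalerBr !scalerA mulrC.
Qed.

Lemma simple_scaled_diff_integral c S1 S2 t w :
  is_simple F S1 -> is_simple F S2 ->
  simple_integral W (simple_scaled_diff c S1 S2) t w =
  c * (simple_integral W S1 t w - simple_integral W S2 t w).
Proof.
move=> [_ t1 _ _] [_ t2 _ _]; have mt := @common_time_homo S1 S2.
have refine S : (forall i, sp_time S i <= sp_time S i.+1) ->
    (forall i, (i <= sp_len S)%N -> exists2 a,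
       (a <= (size (common_times S1 S2)).-1)%N & sp_time S i = common_time S1 S2 a) ->
    simple_integral W S t w = \sum_(j < (size (common_times S1 S2)).-1)
      dot (simple_eval S (common_time S1 S2 j.+1) w)
        (W (Num.min t (common_time S1 S2 j.+1)) w - W (Num.min t (common_time S1 S2 j)) w).
  move=> tS StN.
  rewrite -(@simple_sum_refine _ _ _ _ S _ _ dot (fun s => W (Num.min t s) w)
    (common_time S1 S2)) //.
  - exact: dot0l.
  - exact: dotDl.
  - by move=> v; rewrite dotC dot0l.
  - exact: dotDr.
rewrite (refine _ t1 (@common_timesl S1 S2)) (refine _ t2 (@common_timesr S1 S2)).
rewrite -sumrB mulr_sumr; apply: eq_bigr => j _ /=.
by rewrite dotZl dotDl dotNl.
Qed.

Hypothesis hF : filtration F.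

Lemma simple_time_ge0 S i : is_simple F S -> 0 <= sp_time S i.
Proof. by move=> [t0 tS _ _]; apply: le_trans t0 (simple_time_homo tS _). Qed.

Lemma enorm_eval_bounded S : is_simple F S ->
  exists C : R, forall t w, enorm (simple_eval S t w) <= C.
Proof.
move=> [_ _ _ [C hC]]; pose C' := Num.max C 0.
have C'0 : 0 <= C' by rewrite le_max lexx orbT.
pose c := (sp_len S)%:R * C'; have c0 : 0 <= c by rewrite mulr_ge0.
exists (Num.sqrt (n%:R * c ^+ 2)) => t w.
rewrite -[enorm _]ger0_norm ?enorm_ge0 // -sqrtr_sqr ler_wsqrtr //.
apply: enorm_le_entries => // i; rewrite /simple_eval summxE.
apply: le_trans (ler_norm_sum _ _ _) _.
rewrite /c mulr_natl -[in leRHS](card_ord (sp_len S)) -sumr_const.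
apply: ler_sum => j _; case: ifP => _; last by rewrite mxE normr0.
apply: le_trans (entry_le_enorm _ _) _.
by apply: le_trans (hC j w (ltn_ord j)) _; rewrite le_max lexx.
Qed.

(** The value on [(tau_j, tau_(j+1)]] only involves the [val_i] with
    [t_i < tau_(j+1)], that is [t_i <= tau_j], which are known at time [tau_j]. *)
Lemma simple_scaled_diff_simple c S1 S2 :
  is_simple F S1 -> is_simple F S2 -> is_simple F (simple_scaled_diff c S1 S2).
Proof.
move=> s1 s2; have mt := @common_time_homo S1 S2.
have [sF _ mF] := hF.
have L0 : (0 < size (common_times S1 S2))%N.
  by rewrite size_sort size_cat size_map size_iota.
have ct0 j : 0 <= common_time S1 S2 j.
  apply: le_trans (mt 0%N j _) => //.
  have : common_time S1 S2 0 \in simple_times S1 ++ simple_times S2.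
    by rewrite -(mem_sort <=%R) mem_nth.
  by rewrite mem_cat => /orP[] /mapP[i _ ->]; exact: simple_time_ge0.
have meas_eval S j : is_simple F S ->
    (forall i, (i <= sp_len S)%N -> exists2 a,
       (a <= (size (common_times S1 S2)).-1)%N & sp_time S i = common_time S1 S2 a) ->
    meas_on (F (common_time S1 S2 j)) setT (simple_eval S (common_time S1 S2 j.+1)).
  move=> sS StN; have sFj := sF _ (ct0 j).
  have FT := sigmaT sFj.
  have [_ tS vS _] := sS.
  suff mi (i : 'I_(sp_len S)) : meas_on (F (common_time S1 S2 j)) setT (fun w =>
      if sp_time S i < common_time S1 S2 j.+1 <= sp_time S i.+1
      then sp_val S i w else 0).
    exact (meas_on_sum sFj _ FT mi).
  case: (boolP (sp_time S i < common_time S1 S2 j.+1 <= sp_time S i.+1)); last first.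
    by move=> _; exact (meas_on_cst sFj _ FT).
  move=> /andP[lti _] B oB; rewrite setTI.
  apply: (mF (sp_time S i)); first exact: simple_time_ge0.
    have [a _ aE] := StN i (ltnW (ltn_ord i)); rewrite aE; apply: (mt).
    by rewrite leqNgt; apply/negP => ja; move: lti; rewrite aE ltNge mt.
  exact: vS.
split.
- exact: ct0.
- by move=> i; exact: mt.
- move=> i B _ oB; have sFi := sF _ (ct0 i).
  have m1 := meas_eval S1 i s1 (@common_timesl S1 S2).
  have m2 := meas_eval S2 i s2 (@common_timesr S1 S2).
  have := meas_on_scale c (meas_on_sub sFi m1 m2).
  by move=> /(_ B oB); rewrite setTI.
- have [C1 h1] := enorm_eval_bounded s1; have [C2 h2] := enorm_eval_bounded s2.
  exists (Num.sqrt (c ^+ 2 * (2 * C1 ^+ 2 + 2 * C2 ^+ 2))) => i w _ /=.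
  rewrite -[enorm _]ger0_norm ?enorm_ge0 // -sqrtr_sqr ler_wsqrtr //.
  rewrite enorm_sqrZ ler_wpM2l ?sqr_ge0 //.
  apply: le_trans (enorm_sqrD_le _ _) _.
  have sqr_le (C x : R) : 0 <= x -> x <= C -> 2 * x ^+ 2 <= 2 * C ^+ 2.
    by move=> x0 xC; rewrite ler_wpM2l // lerXn2r // nnegrE (le_trans x0).
  by rewrite enormN lerD // sqr_le ?enorm_ge0.
Qed.

End SimpleLinear.

(** * Null sets, joint measurability and measurable events *)

Section NullSets.
Context {R : realType} {d : measure_display} {Omega : measurableType d}.
Variables (F : R -> set (set Omega)) (P : probability Omega R).
Hypotheses (hF : filtration F) (hFc : complete_filtration F P).

Lemma filtration_sub (t : R) : 0 <= t -> F t `<=` measurable.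
Proof. by case: hF => _ + _; exact. Qed.

Lemma negligible_measurable (N : set Omega) : P.-negligible N -> measurable N.
Proof. by move=> N0; apply: (filtration_sub (lexx 0)); exact: hFc. Qed.

(** Null sets belong to every sigma-algebra of a complete filtration, which
    makes membership insensitive to almost sure modifications. *)
Lemma ae_iff_sigma (G : set (set Omega)) (A A' : set Omega) :
  sigma_algebra setT G -> (forall N, P.-negligible N -> G N) ->
  G A' -> {ae P, forall w, A w <-> A' w} -> G A.
Proof.
move=> sG GN GA' AA'; pose N := ~` [set w | A w <-> A' w].
have N0 : P.-negligible N by [].
rewrite (_ : A = (A' `&` ~` N) `|` (A `&` N)).
  apply: sigmaU => //; first by apply: sigmaI => //; apply: sigmaC => //; exact: GN.
  by apply: GN; apply: negligibleS N0 => w [].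
apply/seteqP; split=> w; last by case=> [[A'w /= /contrapT AA]|[]//]; apply/AA.
move=> Aw; have [Nw|nNw] := pselect (N w); [by right|left; split=> //].
by move: nNw => /contrapT /= <-.
Qed.

Lemma ae_iff_measurable (A A' : set Omega) :
  measurable A' -> {ae P, forall w, A w <-> A' w} -> measurable A.
Proof.
by apply: ae_iff_sigma; [exact: sigma_algebra_measurable_sets|exact: negligible_measurable].
Qed.

Lemma ae_eq_meas_on {V : topologicalType} (G : set (set Omega)) (f g : Omega -> V) :
  sigma_algebra setT G -> (forall N, P.-negligible N -> G N) ->
  meas_on G setT f -> {ae P, forall w, f w = g w} -> meas_on G setT g.
Proof.
move=> sG GN mf fg B oB; apply: ae_iff_sigma (mf B oB) _ => //.
by apply: filterS fg => w /= ->.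
Qed.

(** Monotonicity of [P] is only available between measurable sets; this is why
    measurability of all the events below has to be established. *)
Lemma ae_sub_probability (A B C : set Omega) :
  measurable A -> measurable B -> measurable C ->
  {ae P, forall w, A w -> B w \/ C w} -> (P A <= P B + P C)%E.
Proof.
move=> mA mB mC [N [mN N0 ABC]].
apply: (@le_trans _ _ (P ((B `|` C) `|` N))).
  apply: le_measure; rewrite ?inE //; first by do 2 apply: measurableU => //.
  move=> w Aw; have [Nw|nNw] := pselect (N w); [by right|left].
  have : (A w -> B w \/ C w) by apply: contrapT => h; apply: nNw; exact: ABC.
  exact.
apply: (@le_trans _ _ (P (B `|` C) + P N)%E).
  by apply: measureU2 => //; exact: measurableU.
by rewrite N0 adde0; exact: measureU2.
Qed.

(** Almost sure convergence implies convergence in probability: the unions of the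
    tails of the sequence decrease to a null set. *)
Lemma ae_eventually_cvg_probability (A : nat -> set Omega) :
  (forall k, measurable (A k)) ->
  {ae P, forall w, exists K, forall k, (K <= k)%N -> ~ A k w} ->
  P (A k) @[k --> \oo] --> 0%E.
Proof.
move=> mA Aev; pose B N := \bigcup_(k in [set k | (N <= k)%N]) A k.
have mB N : measurable (B N) by apply: bigcup_measurable => k _; exact: mA.
have PB : (P \o B) x @[x --> \oo] --> P (\bigcap_n B n).
  apply: nonincreasing_cvg_mu => //.
  - by apply: le_lt_trans (probability_le1 P (mB 0%N)) _; exact: ltry.
  - exact: bigcap_measurable.
  - move=> n m nm; apply/subsetPset => w [k /= mk Aw]; exists k => //.
    exact: leq_trans mk.
have B0 : P (\bigcap_n B n) = 0%E.
  apply/eqP; rewrite -measure_le0.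
  have : P.-negligible (\bigcap_n B n).
    apply: negligibleS Aev => w Bw /= [K hK].
    by have [k /= Kk /(hK k Kk)] := Bw K I.
  move=> [N [mN <- BN]]; apply: le_measure => //; rewrite inE //.
  exact: bigcap_measurable.
rewrite B0 in PB.
apply: (squeeze_cvge _ _ PB); last exact: cvg_cst.
near=> k; rewrite measure_ge0 /=; apply: le_measure; rewrite ?inE //.
by move=> w Aw; exists k => //=.
Unshelve. all: by end_near. Qed.

End NullSets.

Section JointMeasurability.
Context {R : realType} {d : measure_display} {Omega : measurableType d}.
Variables (F : R -> set (set Omega)) (P : probability Omega R).
Hypotheses (hF : filtration F) (hFc : complete_filtration F P).
Context {n : nat}.
Implicit Types H : R -> Omega -> 'rV[R]_n.

(** Stated up to indistinguishability, as the integrands of Ito integrals are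
    progressive only up to indistinguishability. *)
Definition jointly_measurable H := exists H' : R -> Omega -> 'rV[R]_n,
  (forall T, 0 <= T -> meas_on measurable [set p : R * Omega | 0 <= p.1 <= T]
                         (fun p => H' p.1 p.2)) /\
  {ae P, forall w, forall t, 0 <= t -> H t w = H' t w}.

Definition sqr_L2dist (T : R) (H K : R -> Omega -> 'rV[R]_n) (w : Omega) : \bar R :=
  (\int[lebesgue_measure]_(s in `[0%R, T]) (enorm (H s w - K s w) ^+ 2)%:E)%E.

Lemma progressive_meas_on (V : topologicalType) (X : R -> Omega -> V) T :
  progressive F X -> 0 <= T ->
  meas_on measurable [set p : R * Omega | 0 <= p.1 <= T] (fun p => X p.1 p.2).
Proof.
move=> pX T0 B oB; have := pX T T0 B oB.
rewrite measurable_prod_measurableType; apply: sub_sigma_algebra2.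
move=> _ [A mA [C FC <-]]; exists A => //; exists C => //.
exact: filtration_sub T0 _ FC.
Qed.

Lemma jointly_measurable_sub H K :
  jointly_measurable H -> jointly_measurable K ->
  jointly_measurable (fun t w => H t w - K t w).
Proof.
move=> [H' [mH HH']] [K' [mK KK']]; exists (fun t w => H' t w - K' t w); split.
  move=> T T0.
  exact (meas_on_sub (sigma_algebra_measurable_sets) (mH T T0) (mK T T0)).
by apply: filterS2 HH' KK' => w h k t t0; rewrite h // k.
Qed.

Lemma time_strip_measurable T : measurable [set p : R * Omega | 0 <= p.1 <= T].
Proof.
rewrite (_ : mkset _ = `[0, T]%classic `*` setT); first exact: measurableX.
by apply/seteqP; split=> p /=; rewrite in_itv /=; [|case].
Qed.

Lemma jointly_measurable_simple (S : simple_process) :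
  is_simple F S -> jointly_measurable (simple_eval (Omega := Omega) (n := n) S).
Proof.
move=> sS; exists (simple_eval S); split; last by apply: filterE.
move=> T T0; have sM := @sigma_algebra_measurable_sets _ (R * Omega)%type.
have mD := time_strip_measurable T; have [_ tS vS _] := sS.
suff mi (i : 'I_(sp_len S)) : meas_on measurable [set p : R * Omega | 0 <= p.1 <= T]
    (fun p => if sp_time S i < p.1 <= sp_time S i.+1 then sp_val S i p.2 else 0).
  exact (meas_on_sum sM _ mD mi).
have mv : meas_on measurable [set p : R * Omega | 0 <= p.1 <= T] (fun p => sp_val S i p.2).
  move=> B oB; apply: measurableI => //.
  rewrite (_ : _ @^-1` _ = setT `*` (sp_val S i @^-1` B)).
    apply: measurableX => //; apply: (filtration_sub hF (simple_time_ge0 i sS)).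
    exact: vS.
  by apply/seteqP; split=> p //= [].
refine (meas_on_if sM _ mv (meas_on_cst sM _ mD)).
apply: measurableI => //.
rewrite (_ : mkset _ = `]sp_time S i, sp_time S i.+1]%classic `*` setT).
  exact: measurableX.
by apply/seteqP; split=> p /=; rewrite in_itv /=; [|case].
Qed.

Section SquareIntegral.
Variables (H' : R -> Omega -> 'rV[R]_n) (T : R).
Hypothesis mH' : meas_on measurable [set p : R * Omega | 0 <= p.1 <= T]
                   (fun p => H' p.1 p.2).

Let sqr_on_strip : R * Omega -> \bar R :=
  (fun p => (enorm (H' p.1 p.2) ^+ 2)%:E) \_ [set p | 0 <= p.1 <= T].

Let measurable_sqr : measurable_fun setT sqr_on_strip.
Proof.
apply/(measurable_restrictT _ (time_strip_measurable T)).
apply/measurable_EFinP; apply: meas_on_measurable_fun.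
exact (meas_on_enorm_sqr (sigma_algebra_measurable_sets) mH').
Qed.

Let restrictE (w : Omega) : (fun s => sqr_on_strip (s, w)) =
  (fun s => (enorm (H' s w) ^+ 2)%:E) \_ `[0, T].
Proof.
apply/funext => s; rewrite /sqr_on_strip /patch /= !mem_setE.
by congr (if _ then _ else _); apply/idP/idP; rewrite !inE /= in_itv.
Qed.

Lemma measurable_sqr_integral : measurable_fun setT
  (fun w => \int[lebesgue_measure]_(s in `[0%R, T]) (enorm (H' s w) ^+ 2)%:E)%E.
Proof.
rewrite (_ : (fun w => _) = fubini_G lebesgue_measure sqr_on_strip); last first.
  by apply/funext => w; rewrite /fubini_G [LHS]integral_mkcond -(restrictE w).
apply: measurable_fun_fubini_tonelli_G => // p.
by rewrite /sqr_on_strip /patch; case: ifP => // _; rewrite lee_fin sqr_ge0.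
Qed.

Lemma measurable_sqr_section (w : Omega) :
  measurable_fun `[0%R, T] (fun s => (enorm (H' s w) ^+ 2)%:E).
Proof.
apply/(measurable_restrictT _ (measurable_itv _)).
rewrite -(restrictE w); exact: measurableT_comp measurable_sqr (measurable_pair2 w).
Qed.

End SquareIntegral.

Lemma ae_measurable_sqr H (T : R) : jointly_measurable H -> 0 <= T ->
  {ae P, forall w, measurable_fun `[0%R, T] (fun s => (enorm (H s w) ^+ 2)%:E)}.
Proof.
move=> [H' [mH HH']] T0; apply: filterS HH' => w HH'.
apply: eq_measurable_fun (measurable_sqr_section (mH T T0) w) => s.
by rewrite inE /= in_itv /= => /andP[s0 _]; rewrite HH'.
Qed.

Lemma measurable_sqr_L2dist_gt H K (T : R) (e : \bar R) :
  jointly_measurable H -> jointly_measurable K -> 0 <= T ->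
  measurable [set w | (e < sqr_L2dist T H K w)%E].
Proof.
move=> jH jK T0; have [L [mL LE]] := jointly_measurable_sub jH jK.
apply: (ae_iff_measurable hF hFc (A' := [set w |
  (e < \int[lebesgue_measure]_(s in `[0%R, T]) (enorm (L s w) ^+ 2)%:E)%E])).
  rewrite -[X in measurable X]setTI.
  apply: emeasurable_fun_o_infty => //.
  exact: (measurable_sqr_integral (mL T T0)).
apply: filterS LE => w LE /=; rewrite /sqr_L2dist.
suff -> : (\int[lebesgue_measure]_(s in `[0%R, T]) (enorm (H s w - K s w) ^+ 2)%:E =
  \int[lebesgue_measure]_(s in `[0%R, T]) (enorm (L s w) ^+ 2)%:E)%E by [].
apply: eq_integral => s.
by rewrite inE /= in_itv /= => /andP[s0 _]; rewrite LE.
Qed.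

Lemma sqr_L2dist_triangle (T : R) H1 H2 H3 :
  jointly_measurable H1 -> jointly_measurable H2 -> jointly_measurable H3 ->
  0 <= T ->
  {ae P, forall w, (sqr_L2dist T H1 H3 w <=
    2%:E * sqr_L2dist T H1 H2 w + 2%:E * sqr_L2dist T H2 H3 w)%E}.
Proof.
move=> j1 j2 j3 T0.
have m13 := ae_measurable_sqr (jointly_measurable_sub j1 j3) T0.
have m12 := ae_measurable_sqr (jointly_measurable_sub j1 j2) T0.
have m23 := ae_measurable_sqr (jointly_measurable_sub j2 j3) T0.
apply: filterS3 m13 m12 m23 => w m13 m12 m23; rewrite /sqr_L2dist.
have e0 (v : 'rV[R]_n) : (0 <= (enorm v ^+ 2)%:E)%E by rewrite lee_fin sqr_ge0.
have me (f : R -> \bar R) : measurable_fun `[0%R, T] f ->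
    measurable_fun `[0%R, T] (fun s => 2%:E * f s)%E by exact: measurable_funeM.
have e20 (v : 'rV[R]_n) : (0 <= 2%:E * (enorm v ^+ 2)%:E)%E by rewrite mule_ge0.
have n12 := me _ m12; have n23 := me _ m23.
rewrite -!ge0_integralZl // -ge0_integralD //.
apply: ge0_le_integral => //; first exact: emeasurable_funD n12 n23.
move=> s _; rewrite -!EFinM -EFinD lee_fin.
by rewrite -[_ - H3 s w](subrKA (H2 s w)); exact: enorm_sqrD_le.
Qed.

(** Continuity reduces the supremum over [[0, T]] to countably many times. *)
Lemma measurable_sup_gt (Z : R -> Omega -> R) (T e : R) :
  (forall t, 0 <= t -> meas_on measurable setT (Z t)) ->
  {ae P, forall w, {within `[0, +oo[, continuous (fun t => Z t w)}} ->
  0 < T -> measurable [set w | exists2 t, 0 <= t <= T & e < `|Z t w|].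
Proof.
move=> mZ cZ T0; (* an enumeration of the rationals of [[0, T]], and [T] *)
pose q (k : nat) : R := Num.min T `|ratr (odflt 0 (unpickle k))|.
have q0 k : 0 <= q k by rewrite le_min normr_ge0 ltW.
apply: (ae_iff_measurable hF hFc (A' := \bigcup_k [set w | e < `|Z (q k) w|])).
  apply: bigcup_measurable => k _; rewrite -[X in measurable X]setTI.
  apply: (mZ _ (q0 k) [set x | e < `|x|]).
  apply: open_comp (@open_gt R e) => x _; exact: norm_continuous.
apply: filterS cZ => w cZ; split=> [[t /andP[t0 tT] et]|[k _ ek]]; last first.
  by exists (q k) => //; rewrite q0 ge_min lexx.
have : \forall s \near within `[0, +oo[%classic (nbhs t), e < `|Z s w|.
  have ct : Z s w @[s --> within `[0, +oo[%classic (nbhs t)] --> Z t w.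
    by move/subspace_continuousP : cZ; apply; rewrite /= in_itv /= t0.
  exact: (cvgr_gt _ (cvg_norm ct) _ et).
rewrite near_withinE -nbhs_ballE => -[h /= h0 hP].
have [r [r0 rT tr]] : exists r : R, [/\ 0 <= r, r <= T & `|t - r| < h /\ exists k, q k = r].
  pose a := Num.max 0 (t - h); pose b := Num.min T (t + h).
  have ab : a < b.
    by rewrite lt_min !gt_max T0 /=; apply/andP; split; [|apply/andP; split]; lra.
  have [c] := rat_in_itvoo ab; rewrite in_itv /= => /andP[ac cb].
  move: ac cb; rewrite gt_max lt_min => /andP[c0 c1] /andP[c2 c3].
  exists (ratr c); split; [exact: ltW|exact: ltW|split].
    by rewrite ltr_norml; apply/andP; split; lra.
  exists (pickle c); rewrite /q pickleK /= ger0_norm; last exact: ltW.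
  by rewrite min_r // ltW.
case: tr => tr [k qk]; exists k => //=; rewrite qk; apply: hP.
  by rewrite -ball_normE.
by rewrite /= in_itv /= r0.
Qed.

End JointMeasurability.

(** * Linearity of the Ito integral *)

Lemma cvge0_leP {R : realType} (u : nat -> \bar R) : (forall k, 0 <= u k)%E ->
  u k @[k --> \oo] --> 0%E <->
  (forall e : R, 0 < e -> exists K, forall k, (K <= k)%N -> (u k <= e%:E)%E).
Proof.
move=> u0; split=> [/fine_cvgP[ufin /cvgrPdist_le u_cv] e e0|u_le].
  have [K _ KP] := filterI ufin (u_cv e e0); exists K => k /KP[uk].
  rewrite sub0r normrN => uke; rewrite -(fineK uk) lee_fin.
  exact: le_trans (ler_norm _) uke.
have fin k (e : R) : (u k <= e%:E)%E -> u k \is a fin_num.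
  by move=> uk; rewrite ge0_fin_numE // (le_lt_trans uk) ?ltry.
apply/fine_cvgP; split.
  by have [K hK] := u_le 1 ltr01; exists K => // k /hK /fin.
apply/cvgrPdist_le => e e0; have [K hK] := u_le e e0; exists K => // k /hK /= uk.
rewrite sub0r normrN ger0_norm ?fine_ge0 //.
by rewrite -lee_fin fineK //; exact: fin uk.
Qed.

Section ItoClosure.
Context {R : realType} {d : measure_display} {Omega : measurableType d}.
Variables (F : R -> set (set Omega)) (P : probability Omega R).
Context {n : nat}.
Variable W : R -> Omega -> 'rV[R]_n.
Hypotheses (hF : filtration F) (hFc : complete_filtration F P).
Hypothesis hW : brownian_motion F P W.
Implicit Types (H K : R -> Omega -> 'rV[R]_n) (M : R -> Omega -> R).
Implicit Types S : simple_process (R := R) (Omega := Omega) (n := n).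

Lemma adaptedP (V : topologicalType) (X : R -> Omega -> V) :
  adapted F X <-> forall t, 0 <= t -> meas_on (F t) setT (X t).
Proof.
by split=> aX t t0 B oB; have := aX t t0 B oB; rewrite setTI.
Qed.

Lemma adapted_measurable (V : topologicalType) (X : R -> Omega -> V) (t : R) :
  adapted F X -> 0 <= t -> meas_on measurable setT (X t).
Proof.
by move=> /adaptedP aX t0 B oB; exact: (filtration_sub hF t0 (aX t t0 B oB)).
Qed.

Lemma simple_integral_measurable S (t : R) : is_simple F S -> 0 <= t ->
  meas_on measurable setT (simple_integral W S t).
Proof.
move=> sS t0; have sM := @sigma_algebra_measurable_sets _ Omega.
have [aW _ _ _] := hW; have [_ tS vS _] := sS.
suff mi (i : 'I_(sp_len S)) : meas_on measurable setT (fun w =>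
    dot (sp_val S i w) (W (Num.min t (sp_time S i.+1)) w - W (Num.min t (sp_time S i)) w)).
  exact (meas_on_sumR _ sM measurableT mi).
have mW (s : R) : 0 <= s -> meas_on measurable setT (W (Num.min t s)).
  by move=> s0; apply: adapted_measurable aW _; rewrite le_min t0.
have mv : meas_on measurable setT (sp_val S i).
  move=> B oB; rewrite setTI; apply: (filtration_sub hF (simple_time_ge0 i sS)).
  exact: vS.
exact (meas_on_dot sM mv (meas_on_sub sM (mW _ (simple_time_ge0 i.+1 sS))
                                         (mW _ (simple_time_ge0 i sS)))).
Qed.

Lemma continuous_dot_const (v : 'rV[R]_n) : continuous (dot v).
Proof.
move=> x A vA; have [[A1 A2] /= [nA1 nA2] AA] := @continuous_dot R n (v, x) A vA.
by apply: filterS nA2 => y A2y; apply: (AA (v, y)); split=> //=; exact: nbhs_singleton.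
Qed.

Lemma simple_integral_continuous S : is_simple F S ->
  {ae P, forall w, {within `[0, +oo[, continuous (fun t => simple_integral W S t w)}}.
Proof.
move=> sS; have [_ _ cW _] := hW; apply: filterS cW => w /subspace_continuousP cW.
apply/subspace_continuousP => t t0; rewrite /simple_integral.
apply: cvg_big => [|i _]; first exact: add_continuous.
have cWi (s : R) : 0 <= s ->
    W (Num.min t' s) w @[t' --> within `[0, +oo[%classic (nbhs t)] --> W (Num.min t s) w.
  move=> s0; have ts0 : `[0, +oo[%classic (Num.min t s).
    by move: t0; rewrite /= !in_itv /= !andbT => t0; rewrite le_min t0.
  have cm : (fun t' : R => Num.min t' s) t' @[t' --> t] --> Num.min t s.
    exact: (@continuous_min _ _ (fun t' : R => t') (fun=> s) t cvg_id (cvg_cst _)).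
  move=> A nA; have nA' : nbhs (Num.min t s) [set x | `[0, +oo[%classic x -> A (W x w)].
    exact: (cW _ ts0 A nA).
  change (nbhs t [set t' | `[0, +oo[%classic t' -> A (W (Num.min t' s) w)]).
  refine (@filterS _ (nbhs t) _ _ _ _ (cm _ nA')) => t' /= AA t'0; apply: AA.
  by move: t'0; rewrite !in_itv /= !andbT => t'0; rewrite le_min t'0.
have cB := cvgB (cWi _ (simple_time_ge0 i.+1 sS)) (cWi _ (simple_time_ge0 i sS)).
by move=> A nA; exact: (cB _ _ (@continuous_dot_const (sp_val S i w) _ A nA)).
Qed.

(** The two events that have to be improbable for [S] to be an approximation of
    [H] whose integral approximates [M]. *)
Definition integrand_far (T e : R) S H : set Omega :=
  [set w | (e%:E < sqr_L2dist T (simple_eval S) H w)%E].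

Definition integral_far (T e : R) S M : set Omega :=
  [set w | exists2 t, 0 <= t <= T & e < `|simple_integral W S t w - M t w|].

Lemma integral_far_measurable T e S M : is_simple F S -> adapted F M ->
  {ae P, forall w, {within `[0, +oo[, continuous (fun t => M t w)}} ->
  0 < T -> measurable (integral_far T e S M).
Proof.
move=> sS aM cM T0.
apply: (@measurable_sup_gt _ _ _ _ _ hF hFc
  (fun t w => simple_integral W S t w - M t w) T e _ _ T0).
  move=> t t0; exact (meas_on_subR (@sigma_algebra_measurable_sets _ Omega)
    (simple_integral_measurable sS t0) (adapted_measurable aM t0)).
apply: filterS2 (simple_integral_continuous sS) cM => w.
move=> /subspace_continuousP c1 /subspace_continuousP c2.
by apply/subspace_continuousP => t t0; apply: cvgB; [exact: c1|exact: c2].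
Qed.

Lemma indist_progressive_jointly H :
  (exists H', progressive F H' /\
     {ae P, forall w, forall t, 0 <= t -> H t w = H' t w}) ->
  jointly_measurable P H.
Proof.
move=> [H' [pH HH']]; exists H'; split=> // T T0.
exact: (progressive_meas_on hF pH T0).
Qed.

Lemma sqr_L2distC T H K w : sqr_L2dist T H K w = sqr_L2dist T K H w.
Proof. by apply: eq_integral => s _; rewrite -enormN opprB. Qed.

Lemma sqr_L2dist0 T H w :
  sqr_L2dist T H (fun _ _ => 0) w =
  (\int[lebesgue_measure]_(s in `[0%R, T]) (enorm (H s w) ^+ 2)%:E)%E.
Proof. by apply: eq_integral => s _; rewrite subr0. Qed.

Lemma jointly_measurable0 : jointly_measurable P (fun (_ : R) _ => 0 : 'rV[R]_n).
Proof.
exists (fun _ _ => 0); split=> [T T0|]; last exact: filterE.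
exact (meas_on_cst (@sigma_algebra_measurable_sets _ _) _ (time_strip_measurable T)).
Qed.

Lemma sqr_L2dist_le_time (T T' : R) H K :
  jointly_measurable P H -> jointly_measurable P K -> 0 <= T -> T <= T' ->
  {ae P, forall w, (sqr_L2dist T H K w <= sqr_L2dist T' H K w)%E}.
Proof.
move=> jH jK T0 TT'.
apply: filterS (ae_measurable_sqr (jointly_measurable_sub jH jK) (le_trans T0 TT')).
move=> w mHK; apply: ge0_subset_integral => //.
- by move=> s _; rewrite lee_fin sqr_ge0.
- by apply: subset_itvl; rewrite bnd_simp.
Qed.

Lemma jointly_measurable_scale (c : R) H :
  jointly_measurable P H -> jointly_measurable P (fun t w => c *: H t w).
Proof.
move=> [H' [mH HH']]; exists (fun t w => c *: H' t w); split.
  by move=> T T0; exact (meas_on_scale c (mH T T0)).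
by apply: filterS HH' => w h t t0; rewrite h.
Qed.

Lemma sqr_L2dist_scale (c T : R) H K :
  jointly_measurable P H -> jointly_measurable P K -> 0 <= T ->
  {ae P, forall w, sqr_L2dist T (fun t w => c *: H t w) (fun t w => c *: K t w) w =
    ((c ^+ 2)%:E * sqr_L2dist T H K w)%E}.
Proof.
move=> jH jK T0.
apply: filterS (ae_measurable_sqr (jointly_measurable_sub jH jK) T0) => w mHK.
rewrite /sqr_L2dist -ge0_integralZl //.
- by apply: eq_integral => s _; rewrite -scalerBr enorm_sqrZ EFinM.
- by move=> s _; rewrite lee_fin sqr_ge0.
- by rewrite lee_fin sqr_ge0.
Qed.

Lemma sqr_L2dist_sub (T : R) H1 H2 K1 K2 :
  jointly_measurable P H1 -> jointly_measurable P H2 ->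
  jointly_measurable P K1 -> jointly_measurable P K2 -> 0 <= T ->
  {ae P, forall w, (sqr_L2dist T (fun t w => H1 t w - H2 t w)%R
                                (fun t w => K1 t w - K2 t w)%R w <=
    2%:E * sqr_L2dist T H1 K1 w + 2%:E * sqr_L2dist T H2 K2 w)%E}.
Proof.
move=> jH1 jH2 jK1 jK2 T0.
have j1 := jointly_measurable_sub jH1 jK1; have j2 := jointly_measurable_sub jH2 jK2.
have := sqr_L2dist_triangle j1 jointly_measurable0 j2 T0; apply: filterS => w.
rewrite sqr_L2dist0 (sqr_L2distC _ (fun _ _ => 0)) sqr_L2dist0; apply: le_trans.
rewrite le_eqVlt; apply/orP; left; apply/eqP; apply: eq_integral => s _.
by congr ((enorm _ ^+ 2)%:E); apply/rowP => j; rewrite !mxE; ring.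
Qed.

Lemma simple_eval_scaled_diff (c : R) S1 S2 : is_simple F S1 -> is_simple F S2 ->
  simple_eval (simple_scaled_diff c S1 S2) =
  (fun t w => c *: (simple_eval S1 t w - simple_eval S2 t w)).
Proof.
move=> s1 s2; apply/funext => t; apply/funext => w.
exact: (simple_scaled_diff_eval _ _ _ s1 s2).
Qed.

Lemma probability_squeeze0 (A B C : nat -> set Omega) :
  (forall k, measurable (A k)) -> (forall k, measurable (B k)) ->
  (forall k, measurable (C k)) ->
  (forall k, {ae P, forall w, A k w -> B k w \/ C k w}) ->
  P (B k) @[k --> \oo] --> 0%E -> P (C k) @[k --> \oo] --> 0%E ->
  P (A k) @[k --> \oo] --> 0%E.
Proof.
move=> mA mB mC ABC B0 C0.
apply: (@squeeze_cvge _ _ _ _ (fun=> 0%E) _ (fun k => P (B k) + P (C k))%E).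
- apply: nearW => k; rewrite measure_ge0 /=.
  exact: ae_sub_probability.
- exact: cvg_cst.
- by rewrite -(adde0 0%E); apply: cvgeD.
Qed.

(** Approximate the integrand by [c (S1 - S2)], where [S1] and [S2] approximate
    [H1] and [H2]; the errors add up, in probability. *)
Lemma ito_scaled_diff (c : R) H1 H2 M1 M2 :
  ito_integral F P W H1 M1 -> ito_integral F P W H2 M2 ->
  ito_integral F P W (fun t w => c *: (H1 t w - H2 t w))
                     (fun t w => c * (M1 t w - M2 t w)).
Proof.
move=> [p1 f1 a1 c1 [S1 [s1 S1P]]] [p2 f2 a2 c2 [S2 [s2 S2P]]].
have j1 := indist_progressive_jointly p1; have j2 := indist_progressive_jointly p2.
have j12 := jointly_measurable_sub j1 j2.
have jc := jointly_measurable_scale c j12.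
pose L t w := c *: (H1 t w - H2 t w); pose N t w := c * (M1 t w - M2 t w).
have aN : adapted F N.
  apply/adaptedP => t t0; have [sF _ _] := hF.
  have cc : continuous (fun x : R => c * x) by exact: mulrl_continuous.
  exact (meas_on_comp cc (meas_on_subR (sF t t0) ((adaptedP M1).1 a1 t t0)
                                                 ((adaptedP M2).1 a2 t t0))).
have cN : {ae P, forall w, {within `[0, +oo[, continuous (fun t => N t w)}}.
  apply: filterS2 c1 c2 => w /subspace_continuousP d1 /subspace_continuousP d2.
  apply/subspace_continuousP => t t0; apply: cvgMr.
  by apply: cvgB; [exact: d1|exact: d2].
have sS k := simple_scaled_diff_simple hF c (s1 k) (s2 k).
have jS k := jointly_measurable_simple P hF (sS k).
have jS1 k := jointly_measurable_simple P hF (s1 k).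
have jS2 k := jointly_measurable_simple P hF (s2 k).
have cc0 : 0 < 4 * (c ^+ 2 + 1) by rewrite mulr_gt0 // ltr_wpDl // sqr_ge0.
have ac0 : 0 < 2 * (`|c| + 1) by rewrite mulr_gt0 // ltr_wpDl.
split; [| |exact: aN|exact: cN|].
- have [H1' [q1 e1]] := p1; have [H2' [q2 e2]] := p2.
  exists (fun t w => c *: (H1' t w - H2' t w)); split.
    move=> t t0; have sG := @smallest_sigma_algebra _ setT
      [set A `*` C | A in (@measurable _ R) & C in F t].
    exact (meas_on_scale c (meas_on_sub sG (q1 t t0) (q2 t t0))).
  by apply: filterS2 e1 e2 => w h1 h2 t t0; rewrite h1 // h2.
- move=> T T0; have T0' := ltW T0.
  have sc := sqr_L2dist_scale c j12 jointly_measurable0 T0'.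
  have tr := sqr_L2dist_triangle j1 jointly_measurable0 j2 T0'.
  apply: filterS2 (filterI sc tr) (filterI (f1 T T0) (f2 T T0)) => w [].
  rewrite !sqr_L2dist0 (sqr_L2distC _ (fun _ _ => 0)) sqr_L2dist0 => {}sc {}tr [g1 g2].
  rewrite (_ : integral _ _ _ = sqr_L2dist T L (fun t w => c *: 0) w); last first.
    by apply: eq_integral => s _; rewrite scaler0 subr0.
  rewrite sc lte_mul_pinfty ?lee_fin ?sqr_ge0 //.
  by apply: le_lt_trans tr _; rewrite lte_add_pinfty // lte_mul_pinfty // lee_fin.
exists (fun k => simple_scaled_diff c (S1 k) (S2 k)); split=> // T e T0 e0.
have T0' := ltW T0; split.
(* If both squared errors are at most [e'], then the squared error of the
   combination is at most [c^2 (2 e' + 2 e') <= e]. *)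
- pose e' := e / (4 * (c ^+ 2 + 1)).
  have e'0 : 0 < e' by rewrite divr_gt0.
  have e'E : e = e' * (4 * (c ^+ 2 + 1)) by rewrite divfK // gt_eqF.
  have [B1 _] := S1P T _ T0 e'0; have [B2 _] := S2P T _ T0 e'0.
  apply: probability_squeeze0 B1 B2 => k; do ?exact: (measurable_sqr_L2dist_gt hF hFc).
  have sc := sqr_L2dist_scale c (jointly_measurable_sub (jS1 k) (jS2 k)) j12 T0'.
  have sb := sqr_L2dist_sub (jS1 k) (jS2 k) j1 j2 T0'.
  apply: filterS2 sc sb => w; rewrite simple_eval_scaled_diff //= => {}sc {}sb far.
  have {}far : (e%:E < (c ^+ 2)%:E * sqr_L2dist T
      (fun t w => simple_eval (S1 k) t w - simple_eval (S2 k) t w)%R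
      (fun t w => H1 t w - H2 t w)%R w)%E by rewrite -sc.
  apply: contrapT => /not_orP[/negP n1' /negP n2'].
  have n1 : (sqr_L2dist T (simple_eval (S1 k)) H1 w <= e'%:E)%E by rewrite leNgt; exact: n1'.
  have n2 : (sqr_L2dist T (simple_eval (S2 k)) H2 w <= e'%:E)%E by rewrite leNgt; exact: n2'.
  move: far; apply/negP; rewrite -leNgt.
  apply: (@le_trans _ _ ((c ^+ 2)%:E * (2%:E * e'%:E + 2%:E * e'%:E))%E).
    apply: lee_wpmul2l; first by rewrite lee_fin sqr_ge0.
    apply: le_trans sb _; apply: leeD; [exact: lee_wpmul2l n1|exact: lee_wpmul2l n2].
  rewrite -!EFinM lee_fin [leRHS]e'E.
  rewrite -mulrDl mulrA mulrC ler_pM2l //.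
  have -> : 2 + 2 = 4 :> R by ring.
  by rewrite [leLHS]mulrC mulrDr mulr1 lerDl.
(* Likewise [|c| (e' + e') <= e]. *)
- pose e' := e / (2 * (`|c| + 1)).
  have e'0 : 0 < e' by rewrite divr_gt0.
  have e'E : e = e' * (2 * (`|c| + 1)) by rewrite divfK // gt_eqF.
  have [_ B1] := S1P T _ T0 e'0; have [_ B2] := S2P T _ T0 e'0.
  apply: probability_squeeze0 B1 B2 => k; do ?exact: integral_far_measurable.
  apply: filterE => w [t t0T].
  rewrite (simple_scaled_diff_integral W c t w (s1 k) (s2 k)) -mulrBr normrM => far.
  apply: contrapT => /not_orP[n1 n2]; move: far; apply/negP; rewrite -leNgt.
  have {}n1 : `|simple_integral W (S1 k) t w - M1 t w| <= e'.
    by rewrite leNgt; apply/negP => h; apply: n1; exists t.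
  have {}n2 : `|simple_integral W (S2 k) t w - M2 t w| <= e'.
    by rewrite leNgt; apply/negP => h; apply: n2; exists t.
  have -> : forall a b x y : R, a - b - (x - y) = (a - x) - (b - y) by move=> *; ring.
  apply: (@le_trans _ _ (`|c| * (e' + e'))).
    by rewrite ler_wpM2l // (le_trans (ler_normB _ _)) // lerD.
  rewrite [leRHS]e'E (_ : `|c| * (e' + e') = e' * (2 * `|c|)); last by ring.
  by rewrite ler_pM2l // ler_pM2l // lerDl.
Qed.

End ItoClosure.

(** * Limits of Ito integrals *)

Section ItoLimit.
Context {R : realType} {d : measure_display} {Omega : measurableType d}.
Variables (F : R -> set (set Omega)) (P : probability Omega R).
Context {n : nat}.
Variable W : R -> Omega -> 'rV[R]_n.
Hypotheses (hF : filtration F) (hFc : complete_filtration F P).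
Hypothesis hW : brownian_motion F P W.

(** The limit is set to 0 on the null set of scenarios where a sequence fails to
    converge or an integrand differs from its progressive version; that null set
    belongs to every [F t]. *)
Lemma indist_progressive_lim (Hk : nat -> R -> Omega -> 'rV[R]_n)
    (H : R -> Omega -> 'rV[R]_n) :
  (forall k, exists H', progressive F H' /\
     {ae P, forall w, forall t, 0 <= t -> Hk k t w = H' t w}) ->
  {ae P, forall w, forall t, 0 <= t -> Hk k t w @[k --> \oo] --> H t w} ->
  exists H', progressive F H' /\
    {ae P, forall w, forall t, 0 <= t -> H t w = H' t w}.
Proof.
move=> /choice[H' H'P] Hlim.
have ae_eq : {ae P, forall w, forall k t, 0 <= t -> Hk k t w = H' k t w}.
  by apply: ae_foralln => k; case: (H'P k).
pose good := [set w | (forall t, 0 <= t -> Hk k t w @[k --> \oo] --> H t w) /\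
                      (forall k t, 0 <= t -> Hk k t w = H' k t w)].
have ae_good : {ae P, forall w, good w} by apply: filterS2 Hlim ae_eq => w h1 h2.
exists (fun t w => if `[< good w >] then H t w else 0); split; last first.
  by apply: filterS ae_good => w gw t t0; case: asboolP.
move=> t t0; have sG := @smallest_sigma_algebra _ setT
  [set A `*` C | A in (@measurable _ R) & C in F t].
have [sF _ _] := hF.
have mstrip : <<s [set A `*` C | A in (@measurable _ R) & C in F t] >>
    [set p : R * Omega | 0 <= p.1 <= t].
  have [p0 _] := H'P 0%N; exact: (meas_on_dom (p0 t t0)).
have mgood : <<s [set A `*` C | A in (@measurable _ R) & C in F t] >>
    ([set p : R * Omega | 0 <= p.1 <= t] `&` [set p | `[< good p.2 >]]).
  apply: (sigmaI sG) => //.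
  apply: sub_sigma_algebra; exists setT => //; exists good.
    by rewrite -[good]setCK; apply: (sigmaC (sF t t0)); exact: hFc.
  by apply/seteqP; split=> p /=; [case=> _ gp; apply/asboolP|move/asboolP].
have mk k : meas_on <<s [set A `*` C | A in (@measurable _ R) & C in F t] >>
    [set p : R * Omega | 0 <= p.1 <= t]
    (fun p => if `[< good p.2 >] then H' k p.1 p.2 else 0).
  have [pk _] := H'P k.
  exact (meas_on_if sG mgood (pk t t0) (meas_on_cst sG _ mstrip)).
have lim_k (p : R * Omega) : 0 <= p.1 <= t ->
    (if `[< good p.2 >] then H' k p.1 p.2 else 0) @[k --> \oo] -->
    (if `[< good p.2 >] then H p.1 p.2 else 0).
  move=> /andP[p0 _]; case: asboolP => [[h1 h2]|_]; last exact: cvg_cst.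
  by under eq_fun do rewrite -h2 //; exact: h1.
exact (meas_on_lim sG mk lim_k).
Qed.

Lemma adapted_lim (Mk : nat -> R -> Omega -> R) (M : R -> Omega -> R) :
  (forall k, adapted F (Mk k)) ->
  {ae P, forall w, forall t, 0 <= t -> Mk k t w @[k --> \oo] --> M t w} ->
  adapted F M.
Proof.
move=> aM Mlim; apply/adaptedP => t t0; have [sF _ _] := hF.
pose good := [set w | forall t, 0 <= t -> Mk k t w @[k --> \oo] --> M t w].
have mgood : F t (setT `&` [set w | `[< good w >]]).
  rewrite setTI (_ : mkset _ = good); last first.
    by apply/seteqP; split=> w /asboolP.
  by rewrite -[good]setCK; apply: (sigmaC (sF t t0)); exact: hFc.
have FT := sigmaT (sF t t0).
have mk k : meas_on (F t) setT (fun w => if `[< good w >] then Mk k t w else 0).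
  exact (meas_on_if (sF t t0) mgood ((adaptedP _ _).1 (aM k) t t0)
                    (meas_on_cst (sF t t0) _ FT)).
have lim_k w : setT w -> (if `[< good w >] then Mk k t w else 0) @[k --> \oo] -->
    (if `[< good w >] then M t w else 0).
  by move=> _; case: asboolP => [h1|_]; [exact: h1|exact: cvg_cst].
apply: (ae_eq_meas_on (sF t t0) _ (meas_on_lim (sF t t0) mk lim_k)).
  by move=> N; exact: hFc.
by apply: filterS Mlim => w h; case: asboolP.
Qed.

Lemma continuous_locally_uniform_lim (f : nat -> R -> R) (g : R -> R) :
  (forall k, {within `[0, +oo[, continuous (f k)}) ->
  (forall T e, 0 < T -> 0 < e -> exists K, forall k, (K <= k)%N ->
     forall t, 0 <= t <= T -> `|f k t - g t| <= e) ->
  {within `[0, +oo[, continuous g}.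
Proof.
move=> cf fg; apply/subspace_continuousP => t t0.
have t0' : 0 <= t by move: t0; rewrite /= in_itv /= andbT.
apply/cvgrPdist_le => e e0; have e3 : 0 < e / 3 by rewrite divr_gt0.
have t1 : 0 < t + 1 by rewrite ltr_wpDl.
have [K /(_ K (leqnn K)) hK] := fg _ _ t1 e3.
have /subspace_continuousP/(_ t t0)/cvgrPdist_le/(_ _ e3) := cf K.
rewrite !near_withinE => cK; near=> s => s0.
have s0' : 0 <= s by move: s0; rewrite /= in_itv /= andbT.
have st : s <= t + 1.
  by apply/ltW; near: s; apply: lt_nbhsl; rewrite ltrDl.
have h1 := hK t; rewrite t0' lerDl ler01 in h1; have {}h1 := h1 isT.
have h2 := hK s; rewrite s0' st in h2; have {}h2 := h2 isT.
have h3 : `|f K t - f K s| <= e / 3 by apply: (near cK s) => //.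
rewrite (_ : g t - g s = - (f K t - g t) + (f K t - f K s) + (f K s - g s)); last by ring.
apply: le_trans (ler_normD _ _) _.
rewrite (_ : e = e / 3 + e / 3 + e / 3); last by field.
by apply: lerD => //; apply: le_trans (ler_normD _ _) _; rewrite normrN lerD.
Unshelve. all: by end_near. Qed.

(** The simple processes that approximate the limit are picked diagonally: the
    [j]-th one approximates, within [1 / (j + 1)] on [[0, j + 1]] in probability,
    an integrand [H_k] with [k] so large that [H_k] and its integral are
    themselves that close to the limits. *)
Theorem ito_limit (Hk : nat -> R -> Omega -> 'rV[R]_n) (Mk : nat -> R -> Omega -> R)
    (H : R -> Omega -> 'rV[R]_n) (M : R -> Omega -> R) :
  (forall k, ito_integral F P W (Hk k) (Mk k)) ->
  {ae P, forall w, forall t, 0 <= t -> Hk k t w @[k --> \oo] --> H t w} ->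
  (forall T e : R, 0 < T -> 0 < e ->
    {ae P, forall w, exists K, forall k, (K <= k)%N ->
       (sqr_L2dist T (Hk k) H w <= e%:E)%E}) ->
  {ae P, forall w, forall T e : R, 0 < T -> 0 < e ->
     exists K, forall k, (K <= k)%N ->
       forall t, 0 <= t <= T -> `|Mk k t w - M t w| <= e} ->
  ito_integral F P W H M.
Proof.
move=> itok Hlim HL2 Mlim.
have Mlim' : {ae P, forall w, forall t, 0 <= t -> Mk k t w @[k --> \oo] --> M t w}.
  apply: filterS Mlim => w hM t t0; apply/cvgrPdist_le => e e0.
  have t1 : 0 < t + 1 by rewrite ltr_wpDl.
  have [K hK] := hM _ _ t1 e0; exists K => // k Kk; rewrite distrC.
  by apply: hK => //; rewrite t0 lerDl ler01.
have pk k : exists H', progressive F H' /\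
    {ae P, forall w, forall t, 0 <= t -> Hk k t w = H' t w} by case: (itok k).
have pH := indist_progressive_lim pk Hlim.
have ak k : adapted F (Mk k) by case: (itok k).
have aM := adapted_lim ak Mlim'.
have ck k : {ae P, forall w, {within `[0, +oo[, continuous (fun t => Mk k t w)}}.
  by case: (itok k).
have cM : {ae P, forall w, {within `[0, +oo[, continuous (fun t => M t w)}}.
  apply: filterS2 (ae_foralln ck) Mlim => w c1 c2.
  exact: continuous_locally_uniform_lim c1 c2.
have jk k := indist_progressive_jointly hF (pk k).
have jH := indist_progressive_jointly hF pH.
have j0 := @jointly_measurable0 R d Omega P n.
split; [exact: pH| |exact: aM|exact: cM|].
  move=> T T0; have T0' := ltW T0.
  have fk k : {ae P, forall w, (sqr_L2dist T (Hk k) (fun _ _ => 0%R) w < +oo)%E}.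
    have [_ + _ _ _] := itok k => /(_ T T0); apply: filterS => w.
    by rewrite sqr_L2dist0.
  have tr k := sqr_L2dist_triangle jH (jk k) j0 T0'.
  apply: filterS3 (ae_foralln fk) (ae_foralln tr) (HL2 T 1 T0 ltr01).
  move=> w {}fk {}tr [K /(_ K (leqnn K))]; rewrite sqr_L2distC => hK.
  rewrite -sqr_L2dist0; apply: le_lt_trans (tr K) _.
  have twice (x : \bar R) : (x < +oo -> 2%:E * x < +oo)%E by exact: lte_mul_pinfty.
  apply: lte_add_pinfty; apply: twice; last exact: fk.
  exact: le_lt_trans hK (ltry _).
have T0 (j : nat) : 0 < j.+1%:R :> R by [].
have e0 (j : nat) : 0 < j.+1%:R^-1 :> R by rewrite invr_gt0.
pose dist_far j k := [set w | ((j.+1%:R^-1 : R)%:E < sqr_L2dist j.+1%:R (Hk k) H w)%E].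
pose sup_far j k := [set w | exists2 t : R, 0 <= t <= j.+1%:R &
  j.+1%:R^-1 < `|Mk k t w - M t w|].
have mdist j k : measurable (dist_far j k).
  exact: (measurable_sqr_L2dist_gt hF hFc _ (jk k) jH (ltW (T0 j))).
have msup j k : measurable (sup_far j k).
  apply: (@measurable_sup_gt _ _ _ _ _ hF hFc (fun t w => Mk k t w - M t w)) => //.
    move=> t t0; exact (meas_on_subR (@sigma_algebra_measurable_sets _ Omega)
      (adapted_measurable hF (ak k) t0) (adapted_measurable hF aM t0)).
  apply: filterS2 (ck k) cM => w /subspace_continuousP c1 /subspace_continuousP c2.
  by apply/subspace_continuousP => t t0; apply: cvgB; [exact: c1|exact: c2].
have /choice[S SP] : forall j, exists S : simple_process (R := R) (Omega := Omega) (n := n),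
    is_simple F S /\ exists k,
    [/\ (P (dist_far j k) <= (j.+1%:R^-1 : R)%:E)%E,
        (P (sup_far j k) <= (j.+1%:R^-1 : R)%:E)%E,
        (P (integrand_far j.+1%:R j.+1%:R^-1 S (Hk k)) <= (j.+1%:R^-1 : R)%:E)%E &
        (P (integral_far W j.+1%:R j.+1%:R^-1 S (Mk k)) <= (j.+1%:R^-1 : R)%:E)%E].
  move=> j.
  have d0 : P (dist_far j k) @[k --> \oo] --> 0%E.
    apply: (ae_eventually_cvg_probability (mdist j)).
    apply: filterS (HL2 _ _ (T0 j) (e0 j)) => w [K hK]; exists K => k /hK.
    by rewrite leNgt => /negP.
  have s0 : P (sup_far j k) @[k --> \oo] --> 0%E.
    apply: (ae_eventually_cvg_probability (msup j)).
    apply: filterS Mlim => w /(_ _ _ (T0 j) (e0 j))[K hK]; exists K => k /hK {}hK.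
    by move=> [t /hK]; rewrite leNgt => /negP.
  have [K1 h1] := (cvge0_leP (fun k => measure_ge0 P _)).1 d0 _ (e0 j).
  have [K2 h2] := (cvge0_leP (fun k => measure_ge0 P _)).1 s0 _ (e0 j).
  pose k := maxn K1 K2.
  have [_ _ _ _ [Sk [sS /(_ _ _ (T0 j) (e0 j))[i1 i2]]]] := itok k.
  have [L1 g1] := (cvge0_leP (fun k => measure_ge0 P _)).1 i1 _ (e0 j).
  have [L2 g2] := (cvge0_leP (fun k => measure_ge0 P _)).1 i2 _ (e0 j).
  exists (Sk (maxn L1 L2)); split; first exact: sS.
  exists k; split; [exact/h1/leq_maxl|exact/h2/leq_maxr|
                    exact/g1/leq_maxl|exact/g2/leq_maxr].
exists S; split=> [k|T e T00 e00]; first by case: (SP k).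
have small (u : nat -> \bar R) : (forall j, (0 <= u j)%E) ->
    (exists J, forall j, (J <= j)%N ->
       (u j <= (j.+1%:R^-1 : R)%:E + (j.+1%:R^-1 : R)%:E)%E) ->
    u j @[j --> \oo] --> 0%E.
  move=> u0 [J hJ]; apply/(cvge0_leP u0) => a a0.
  have a2 : 0 < a / 2 by rewrite divr_gt0.
  have [m ma] := invr_succ_lt a2; exists (maxn J m) => j.
  rewrite geq_max => /andP[/hJ uj mj]; apply: le_trans uj _.
  rewrite -EFinD lee_fin [leRHS]splitr; have : j.+1%:R^-1 <= a / 2.
    by apply: le_trans (ltW ma); rewrite lef_pV2 ?posrE // ler_nat.
  by move=> ja; exact: lerD.
(* The factor 4 is the cost of the triangle inequality for squared distances. *)
have [m4 em4] : exists m, forall j, (m <= j)%N -> T <= j.+1%:R /\ 4 * j.+1%:R^-1 <= e.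
  have e4 : 0 < e / 4 by rewrite divr_gt0.
  have [m1 em1] := invr_succ_lt e4.
  have [m2 Tm2] : exists m, T <= m.+1%:R.
    by exists (Num.truncn T); exact/ltW/truncnS_gt.
  exists (maxn m1 m2) => j; rewrite geq_max => /andP[j1 j2]; split.
    by apply: le_trans Tm2 _; rewrite ler_nat.
  rewrite mulrC -ler_pdivlMr //; apply: le_trans (ltW em1).
  by rewrite lef_pV2 ?posrE // ler_nat.
split.
- apply: small => [j|]; first exact: measure_ge0.
  exists m4 => j /em4[Tj ej]; have [sS [k [P1 _ P3 _]]] := SP j.
  have jS := jointly_measurable_simple P hF sS.
  apply: le_trans (leeD P3 P1).
  apply: ae_sub_probability.
  + exact: (measurable_sqr_L2dist_gt hF hFc _ jS jH (ltW T00)).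
  + exact: (measurable_sqr_L2dist_gt hF hFc _ jS (jk k) (ltW (T0 j))).
  + exact: mdist.
  have tr := sqr_L2dist_triangle jS (jk k) jH (ltW (T0 j)).
  apply: filterS2 (sqr_L2dist_le_time jS jH (ltW T00) Tj) tr => w mon {}tr far.
  apply: contrapT => /not_orP[/negP n1' /negP n2'].
  have n1 : (sqr_L2dist j.+1%:R (simple_eval (S j)) (Hk k) w <= (j.+1%:R^-1 : R)%:E)%E.
    by rewrite leNgt; exact: n1'.
  have n2 : (sqr_L2dist j.+1%:R (Hk k) H w <= (j.+1%:R^-1 : R)%:E)%E.
    by rewrite leNgt; exact: n2'.
  move: far; apply/negP; rewrite -leNgt.
  apply: le_trans mon _; apply: le_trans tr _.
  apply: (@le_trans _ _ (2%:E * (j.+1%:R^-1 : R)%:E + 2%:E * (j.+1%:R^-1 : R)%:E)%E).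
    by apply: leeD; [exact: lee_wpmul2l n1|exact: lee_wpmul2l n2].
  rewrite -!EFinM lee_fin; apply: le_trans ej.
  by rewrite -mulrDl (_ : 2 + 2 = 4 :> R) //; ring.
- apply: small => [j|]; first exact: measure_ge0.
  exists m4 => j /em4[Tj ej]; have [sS [k [_ P2 _ P4]]] := SP j.
  apply: le_trans (leeD P4 P2).
  apply: ae_sub_probability.
  + exact: (integral_far_measurable hF hFc hW e sS aM cM T00).
  + exact: (integral_far_measurable hF hFc hW _ sS (ak k) (ck k) (T0 j)).
  + exact: msup.
  apply: filterE => w [t /andP[t0 tT] far].
  have tj : 0 <= t <= j.+1%:R by rewrite t0 (le_trans tT).
  apply: contrapT => /not_orP[n1' n2']; move: far; apply/negP; rewrite -leNgt.
  have n1 : `|simple_integral W (S j) t w - Mk k t w| <= j.+1%:R^-1.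
    by rewrite leNgt; apply/negP => h; apply: n1'; exists t.
  have n2 : `|Mk k t w - M t w| <= j.+1%:R^-1.
    by rewrite leNgt; apply/negP => h; apply: n2'; exists t.
  apply: le_trans (ler_distD (Mk k t w) _ _) _; apply: le_trans (lerD n1 n2) _.
  apply: le_trans ej; rewrite -[leLHS]mulr2n -[leLHS]mulr_natl.
  by rewrite ler_wpM2r ?ler_nat // ltW.
Qed.

End ItoLimit.

(** * Rate of convergence of difference quotients *)

Section NonmeasurableDomination.
Local Open Scope ereal_scope.
Context {d : measure_display} {T : measurableType d} {R : realType}.
Variable mu : {measure set T -> \bar R}.

(** The integral of a nonnegative function is a supremum over the simple functions
    below it, hence monotone whether or not the function is measurable. *)
Lemma ge0_le_lower_integral (D D' : set T) (f g : T -> \bar R) : D `<=` D' ->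
  (forall x, D x -> 0 <= f x) -> (forall x, D' x -> 0 <= g x) ->
  (forall x, D x -> f x <= g x) ->
  \int[mu]_(x in D) f x <= \int[mu]_(x in D') g x.
Proof.
move=> DD f0 g0 fg; rewrite !ge0_integralE //.
apply: ge_ereal_sup => _ [h hf <-]; apply: ereal_sup_ubound; exists h => // x.
apply: le_trans (hf x) _; rewrite /patch; case: ifPn => [/set_mem Dx|_].
  by rewrite mem_set ?fg //; exact: DD.
by case: ifPn => // /set_mem; exact: g0.
Qed.

(** The dominating function [g] will be a seminorm in the space variable, that
    is, an uncountable supremum whose measurability in time is unknown. *)
Lemma integral_le_scaled (D D' : set T) (c : R) (f g : T -> \bar R) :
  measurable D -> (0 < c)%R -> measurable_fun D f -> D `<=` D' ->
  (forall x, D x -> 0 <= f x) -> (forall x, D' x -> 0 <= g x) ->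
  (forall x, D x -> f x <= c%:E * g x) ->
  \int[mu]_(x in D) f x <= c%:E * \int[mu]_(x in D') g x.
Proof.
move=> mD c0 mf DD f0 g0 fg.
have cV0 : (0 <= c^-1)%R by rewrite invr_ge0 ltW.
rewrite -lee_pdivrMl //; rewrite -ge0_integralZl ?lee_fin //.
apply: ge0_le_lower_integral => //.
  by move=> x Dx; rewrite mule_ge0 // ?lee_fin //; exact: f0.
by move=> x Dx; rewrite lee_pdivrMl //; exact: fg.
Qed.

End NonmeasurableDomination.

Section SecondOrder.
Context {R : realType}.

(** The mean value theorem, applied to [f] and then to its derivative. *)
Lemma quotient_error_le (f f1 f2 : R -> R) (x h C : R) : 0 < h ->
  (forall z, x <= z <= x + h -> is_derive z 1 f (f1 z)) ->
  (forall z, x <= z <= x + h -> is_derive z 1 f1 (f2 z)) ->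
  (forall z, x <= z <= x + h -> `|f2 z| <= C) ->
  `|h^-1 * (f (h + x) - f x) - f1 x| <= h * C.
Proof.
move=> h0 df df1 bf2.
have cont (g g1 : R -> R) b : b <= x + h ->
    (forall z, x <= z <= x + h -> is_derive z 1 g (g1 z)) ->
    {within `[x, b], continuous g}.
  move=> bxh dg; apply: derivable_within_continuous => z.
  by rewrite in_itv /= => /andP[xz zb]; case: (dg z) => //; rewrite xz (le_trans zb).
have xxh : x < x + h by rewrite ltrDl.
have [c cI fE] : exists2 c, c \in `]x, x + h[%R & f (x + h) - f x = f1 c * (x + h - x).
  apply: MVT; [exact: xxh| |exact: cont df].
  by move=> z; rewrite in_itv /= => /andP[/ltW xz /ltW zx]; apply: df; rewrite xz.
move: cI; rewrite in_itv /= => /andP[xc cxh].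
have [c' c'I f1E] : exists2 c', c' \in `]x, c[%R & f1 c - f1 x = f2 c' * (c - x).
  apply: MVT; [exact: xc| |exact: cont (ltW cxh) df1].
  move=> z; rewrite in_itv /= => /andP[/ltW xz zc]; apply: df1.
  by rewrite xz ltW // (lt_trans zc).
move: c'I; rewrite in_itv /= => /andP[/ltW xc' c'c].
rewrite (addrC h) fE addrAC subrr add0r mulrCA mulVf ?gt_eqF // mulr1 f1E normrM mulrC.
apply: ler_pM => //; last by apply: bf2; rewrite xc' ltW // (lt_trans c'c).
by rewrite ger0_norm ?subr_ge0 ?(ltW xc) // lerBlDl ltW.
Qed.

Lemma cvg_quotient {V : normedModType R} (f : R -> V) (x : R) :
  derivable f x 1 ->
  (k.+1%:R^-1 : R)^-1 *: (f (k.+1%:R^-1 + x) - f x) @[k --> \oo] --> derive1 f x.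
Proof.
move=> df; have cv : h^-1 *: (f (h + x) - f x) @[h --> 0^'] --> derive1 f x.
  have := df; rewrite /derivable.
  by under eq_fun do rewrite [_ *: (1 : R)]mulr1.
have hk : (k.+1%:R^-1 : R) @[k --> \oo] --> 0^'.
  move=> A [e /= e0 eA]; have /cvgrPdist_lt/(_ _ e0) := @cvg_harmonic R.
  by apply: filterS => k; rewrite /harmonic /= => ke; apply: eA => //=.
exact: (cvg_comp _ _ hk cv).
Qed.

Section Seminorm.
Context {V : normedModType R} (N : V -> R).
Variables (delta : R) (K : set R) (f : R -> V).

Lemma sup_nonneg_ge0 (A : set \bar R) : (0 <= sup_nonneg A)%E.
Proof. by apply: ereal_sup_ubound; left. Qed.

Lemma seminorm2_ge (j : nat) (z : R) : (1 <= j <= 2)%N -> K z ->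
  ((N (derive1n j f z))%:E <= seminorm N 2 delta K f)%E.
Proof.
move=> j12 Kz; rewrite /seminorm big_nat_recl // big_nat1.
set a := sup_nonneg _; set b := sup_nonneg _; set c := sup_nonneg _.
set e := sup_nonneg _.
have a0 : (0 <= a)%E by exact: sup_nonneg_ge0.
have b0 : (0 <= b)%E by exact: sup_nonneg_ge0.
have c0 : (0 <= c)%E by exact: sup_nonneg_ge0.
have e0 : (0 <= e)%E by exact: sup_nonneg_ge0.
case: j j12 => [|[|[|]]] // _.
  apply: (@le_trans _ _ b); first by apply: ereal_sup_ubound; right; exists z.
  apply: le_trans (leeDl _ e0); apply: le_trans (leeDr _ a0); exact: leeDl.
apply: (@le_trans _ _ c); first by apply: ereal_sup_ubound; right; exists z.
apply: le_trans (leeDl _ e0); apply: le_trans (leeDr _ a0); exact: leeDr.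
Qed.

Lemma seminorm2_ge0 : (0 <= seminorm N 2 delta K f)%E.
Proof.
rewrite /seminorm big_nat_recl // big_nat1.
by rewrite !adde_ge0 //; exact: sup_nonneg_ge0.
Qed.

End Seminorm.

Definition right_segment (x : R) : set R := `[x, x + 1]%classic.

Lemma right_segment_sub (x h z : R) : h <= 1 -> x <= z <= x + h ->
  right_segment x z.
Proof.
move=> h1 /andP[xz zh]; rewrite /right_segment /= in_itv /= xz (le_trans zh) //.
by rewrite lerD2l.
Qed.

Lemma quotient_error_seminorm (delta x h : R) (f : R -> R) :
  0 < x -> 0 < h <= 1 -> class_C 2 f ->
  ((`|h^-1 * (f (h + x) - f x) - derive1 f x|%R)%:E <=
   h%:E * seminorm Num.norm 2 delta (right_segment x) f)%E.
Proof.
move=> x0 /andP[h0 h1] [df _].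
have := seminorm2_ge (Num.norm : R -> R) delta (K := right_segment x) f.
have := seminorm2_ge0 (Num.norm : R -> R) delta (right_segment x) f.
case: (seminorm _ _ _ _ _) => [C _ hC|_ _|//]; last first.
  by rewrite mulry gtr0_sg // mul1e leey.
rewrite -EFinM lee_fin; apply: (@quotient_error_le f (derive1 f) (derive1n 2 f) x h C h0).
- move=> z /andP[xz _]; apply: derive1_is_derive.
  exact: (df 0%N z isT (lt_le_trans x0 xz)).
- move=> z /andP[xz _]; apply: derive1_is_derive.
  exact: (df 1%N z isT (lt_le_trans x0 xz)).
- by move=> z /(right_segment_sub h1) Kz; rewrite -lee_fin; exact: (hC 2%N).
Qed.

Lemma is_derive_entry (n : nat) (g : R -> 'rV[R]_n) (z : R) (i : 'I_n) :
  derivable g z 1 -> is_derive z 1 (fun y => g y ord0 i) (derive1 g z ord0 i).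
Proof.
move=> dg; have /derivable_mxP dgi := dg.
by apply: DeriveDef => //; rewrite derive1E derive_mx // mxE.
Qed.

(** The mean value theorem holds entrywise, at the cost of a factor [n]; the
    factor [n + 1] is positive also when [n = 0], so that the bound remains true
    when the seminorm is infinite. *)
Lemma quotient_error_seminorm_rV (n : nat) (delta x h : R) (g : R -> 'rV[R]_n) :
  0 < x -> 0 < h <= 1 -> class_C 2 g ->
  ((enorm (h^-1 *: (g (h + x) - g x) - derive1 g x) ^+ 2)%R%:E <=
   (n.+1%:R * h ^+ 2)%R%:E * seminorm enorm 2 delta (right_segment x) g ^+ 2)%E.
Proof.
move=> x0 /andP[h0 h1] [dg _].
have := seminorm2_ge (enorm : 'rV[R]_n -> R) delta (K := right_segment x) g.
have := seminorm2_ge0 (enorm : 'rV[R]_n -> R) delta (right_segment x) g.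
have nh0 : 0 < n.+1%:R * h ^+ 2 by rewrite mulr_gt0 // exprn_gt0.
case: (seminorm _ _ _ _ _) => [C C0 hC|_ _|//]; last first.
  by rewrite expe2 mulyy mulry gtr0_sg // mul1e leey.
rewrite -EFin_expe -EFinM lee_fin; rewrite lee_fin in C0.
apply: (@le_trans _ _ (n%:R * (h * C) ^+ 2)); last first.
  by rewrite exprMn mulrA ler_wpM2r ?sqr_ge0 // ler_wpM2r ?sqr_ge0 // ler_nat.
apply: enorm_le_entries => [|i]; first by rewrite mulr_ge0 // ltW.
rewrite !mxE.
apply: (@quotient_error_le (fun z => g z ord0 i) (fun z => derive1 g z ord0 i)
  (fun z => derive1n 2 g z ord0 i) x h C h0).
- move=> z /andP[xz _]; apply: is_derive_entry.
  exact: (dg 0%N z isT (lt_le_trans x0 xz)).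
- move=> z /andP[xz _]; apply: is_derive_entry.
  exact: (dg 1%N z isT (lt_le_trans x0 xz)).
- move=> z /(right_segment_sub h1) Kz; apply: le_trans (entry_le_enorm _ _) _.
  by rewrite -lee_fin; exact: (hC 2%N).
Qed.

End SecondOrder.

(** * Differentiation of an Ito random field in space *)

Section DifferentiatedField.
Context {R : realType} {d : measure_display} {Omega : measurableType d}.
Variables (F : R -> set (set Omega)) (P : probability Omega R).
Context {n : nat}.
Variable W : R -> Omega -> 'rV[R]_n.
Hypotheses (hF : filtration F) (hFc : complete_filtration F P).
Hypothesis hW : brownian_motion F P W.

(** The constant sequence [H] converges to any indistinguishable [H']. *)
Lemma ito_integral_ae_eq (H H' : R -> Omega -> 'rV[R]_n) (M : R -> Omega -> R) :
  ito_integral F P W H M ->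
  {ae P, forall w, forall t, 0 <= t -> H t w = H' t w} ->
  ito_integral F P W H' M.
Proof.
move=> iH HH'; apply: (ito_limit hF hFc hW (Hk := fun=> H) (Mk := fun=> M)) => //.
- by apply: filterS HH' => w h t t0; rewrite -h //; exact: cvg_cst.
- move=> T e T0 e0; apply: filterS HH' => w h; exists 0%N => k _.
  rewrite /sqr_L2dist integral0_eq; first by rewrite lee_fin ltW.
  move=> s; rewrite /= in_itv /= => /andP[s0 _].
  by rewrite h // subrr enorm_sqr dot0l.
- apply: filterE => w T e T0 e0; exists 0%N => k _ t _.
  by rewrite subrr normr0 ltW.
Qed.

Lemma ito_field_ae_eq (G phi phi' : R -> R -> Omega -> R)
    (psi psi' : R -> R -> Omega -> 'rV[R]_n) :
  ito_field F P W G phi psi ->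
  {ae P, forall w, forall t x, 0 <= t -> 0 < x ->
     phi t x w = phi' t x w /\ psi t x w = psi' t x w} ->
  ito_field F P W G phi' psi'.
Proof.
move=> iG E x x0; have [iphi [M [iM GM]]] := iG x x0; split.
  apply: filterS2 iphi E => w ip e T T0; apply: eq_integrable (ip T T0) => //.
  by move=> s; rewrite inE /= in_itv /= => /andP[s0 _]; rewrite (e s x s0 x0).1.
exists M; split.
  by apply: ito_integral_ae_eq iM _; apply: filterS E => w e t t0; exact: (e t x t0 x0).2.
apply: filterS2 GM E => w g e t t0; rewrite g //; congr (_ + _ + _).
apply: eq_Rintegral => s; rewrite inE /= in_itv /= => /andP[s0 _].
exact: (e s x s0 x0).1.
Qed.

Lemma continuous_field_bounded (w : Omega) (G : R -> R -> Omega -> R) (T x : R) :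
  continuous_field w G -> 0 < x ->
  exists C : R, forall t z, 0 <= t <= T -> right_segment x z -> `|G t z w| <= C.
Proof.
move=> cG x0; pose B : set (R * R) := `[0, T]%classic `*` right_segment x.
have cB : compact B by apply: compact_setX; exact: segment_compact.
have cGB : {within B, continuous (fun p : R * R => G p.1 p.2 w)}.
  apply: continuous_subspaceW cG => p [/=]; rewrite /right_segment /= !in_itv /=.
  by move=> /andP[p0 _] /andP[xp _]; split=> //; exact: lt_le_trans xp.
have [C [_ hC]] := compact_bounded (continuous_compact cGB cB).
exists (C + 1) => t z tT xz; apply: (hC (C + 1)); first by rewrite ltrDl.
by exists (t, z) => //; split=> //=; rewrite in_itv.
Qed.

(** Difference quotients in [x] of the decomposition of [G] converge term by
    term: the field itself and its drift pathwise, locally uniformly in time,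
    the integrand of the stochastic integral in [L^2([0, T])]. Since the integral
    of the difference quotients then converges too, it converges to the integral
    of the limit. The rate [k^-1] comes from the bound of the second derivative
    that is part of the seminorm. *)
Theorem ito_field_dx (delta : R) (G phi : R -> R -> Omega -> R)
    (psi : R -> R -> Omega -> 'rV[R]_n) :
  K_regular F P W 2 delta G phi psi ->
  {ae P, forall w, forall t, 0 <= t -> class_C 2 (G t ^~ w)} ->
  {ae P, forall w, continuous_field w (dx (dx G))} ->
  ito_field F P W (dx G) (dx phi) (dx psi).
Proof.
move=> [itoG _ [_ phiC phiK] [_ psiC psiK]] GC Gcont x x0.
pose h (k : nat) : R := k.+1%:R^-1.
have h0 k : 0 < h k by rewrite invr_gt0.
have h01 k : 0 < h k <= 1 by rewrite h0 invf_le1 // ler1n.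
have hx0 k : 0 < h k + x by rewrite addr_gt0.
have [iphi [M0 [iM0 GM0]]] := itoG x x0.
have iphik k := (itoG (h k + x) (hx0 k)).1.
have /choice[Mk MkP] : forall k, exists M,
    ito_integral F P W (fun t => psi t (h k + x)) M /\
    {ae P, forall w, forall t, 0 <= t -> G t (h k + x) w = G 0 (h k + x) w
       + \int[lebesgue_measure]_(s in `[0, t]) phi s (h k + x) w + M t w}.
  by move=> k; exact: (itoG (h k + x) (hx0 k)).2.
have K_cpt : compact (right_segment x) by exact: segment_compact.
have K_pos : right_segment x `<=` `]0, +oo[%classic.
  move=> z; rewrite /right_segment /= !in_itv /= andbT => /andP[xz _].
  exact: lt_le_trans xz.
pose phi_norm t w := seminorm Num.norm 2 delta (right_segment x) (phi t ^~ w).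
pose psi_norm t w := seminorm enorm 2 delta (right_segment x) (psi t ^~ w).
have phi_norm0 t w : (0 <= phi_norm t w)%E by exact: seminorm2_ge0.
have psi_norm0 t w : (0 <= psi_norm t w)%E by exact: seminorm2_ge0.
pose q k s w : R := (h k)^-1 * (phi s (h k + x) w - phi s x w).
have phi_fin : {ae P, forall w, forall N : nat,
    (\int[lebesgue_measure]_(s in `[0%R, N.+1%:R]) phi_norm s w < +oo)%E}.
  by apply: ae_foralln => N; exact: (phiK _ _ K_cpt K_pos (ltr0Sn R N)).
have itv_sub (T : R) : exists N : nat, T <= N.+1%:R.
  by exists (Num.truncn T); exact/ltW/truncnS_gt.
(* The drift: the space derivative is measurable in time as a limit of the
   quotients, and both integrability and the rate of convergence come from the
   seminorm. *)
have drift_ok : {ae P, forall w, forall T : R, 0 < T ->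
  [/\ lebesgue_measure.-integrable `[0, T] (fun s => (dx phi s x w)%:E),
      forall k, lebesgue_measure.-integrable `[0, T] (fun s => (q k s w)%:E) &
      exists2 C : R, 0 <= C & forall k, (\int[lebesgue_measure]_(s in `[0%R, T])
        `|q k s w - dx phi s x w|%R%:E <= (h k * C)%:E)%E]}.
  apply: filterS2 (filterI phiC phi_fin) (filterI iphi (ae_foralln iphik)).
  move=> w [{}phiC {}phi_fin] [ix ixk] T T0.
  have [N TN] := itv_sub T.
  have sub : (`[0, T]%classic : set R) `<=` `[0, N.+1%:R]%classic.
    by apply: subset_itvl; rewrite bnd_simp.
  have iq k : lebesgue_measure.-integrable `[0, T] (fun s => (q k s w)%:E).
    rewrite (_ : (fun s => _) = (fun s => ((h k)^-1)%:E *
        ((phi s (h k + x)%R w)%:E - (phi s x w)%:E))%E); last first.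
      by apply/funext => s; rewrite -EFinB -EFinM.
    apply: integrableZl => //; apply: integrableB => //.
    - exact: ixk.
    - exact: ix.
  have cv s : s \in `[0, T]%classic -> q k s w @[k --> \oo] --> dx phi s x w.
    rewrite inE /= in_itv /= => /andP[s0 _].
    have [[dphi _] _] := phiC s s0; exact: (cvg_quotient (dphi 0%N x isT x0)).
  have mq k : measurable_fun `[0, T] (fun s => q k s w).
    by apply/measurable_EFinP; exact: measurable_int (iq k).
  have mdphi : measurable_fun `[0, T] (fun s => dx phi s x w).
    apply: (measurable_fun_cvg (h := fun k s => q k s w)) => // s sT.
    by apply: cv; rewrite inE.
  have idphi : lebesgue_measure.-integrable `[0, T] (fun s => (dx phi s x w)%:E).
    apply/integrableP; split; first exact/measurable_EFinP.
    apply: le_lt_trans (phi_fin N); apply: ge0_le_lower_integral => //.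
    move=> s; rewrite /= in_itv /= => /andP[s0 _].
    apply: (@seminorm2_ge _ _ Num.norm delta _ (phi s ^~ w) 1%N x) => //.
    by rewrite /right_segment /= in_itv /= lexx lerDl ler01.
  split=> //; have Ifin : (\int[lebesgue_measure]_(s in `[0%R, N.+1%:R]) phi_norm s w)%E
      \is a fin_num by rewrite ge0_fin_numE ?phi_fin // integral_ge0.
  exists (fine (\int[lebesgue_measure]_(s in `[0%R, N.+1%:R]) phi_norm s w)%E).
    by rewrite fine_ge0 // integral_ge0.
  move=> k; rewrite EFinM fineK //; apply: integral_le_scaled => //.
  - apply/measurable_EFinP.
    exact: measurableT_comp (@normr_measurable R setT) (measurable_funB (mq k) mdphi).
  - move=> s; rewrite /= in_itv /= => /andP[s0 _].
    have [phiC2 _] := phiC s s0.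
    exact: (quotient_error_seminorm delta x0 (h01 k) phiC2).
split; first by apply: filterS drift_ok => w ok T /ok[].
pose M t w := dx G t x w - dx G 0 x w
  - \int[lebesgue_measure]_(s in `[0, t]) dx phi s x w.
exists M; split; last first.
  by apply: filterE => w t t0; rewrite /M; ring.
pose Mq k t w := (h k)^-1 * (Mk k t w - M0 t w).
pose Hq k t w := (h k)^-1 *: (psi t (h k + x) w - psi t x w).
have iq k : ito_integral F P W (Hq k) (Mq k).
  exact: (ito_scaled_diff hF hFc hW (h k)^-1 (MkP k).1 iM0).
have Hlim : {ae P, forall w, forall t, 0 <= t -> Hq k t w @[k --> \oo] --> dx psi t x w}.
  apply: filterS psiC => w {}psiC t t0; have [[dpsi _] _] := psiC t t0.
  exact: (cvg_quotient (dpsi 0%N x isT x0)).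
apply: (ito_limit hF hFc hW iq Hlim).
- move=> T e T0 e0.
  have pk k : exists H', progressive F H' /\
      {ae P, forall w, forall t, 0 <= t -> Hq k t w = H' t w} by case: (iq k).
  have jH := indist_progressive_jointly hF (indist_progressive_lim hF hFc pk Hlim).
  have jk k := indist_progressive_jointly hF (pk k).
  have mk : {ae P, forall w, forall k, measurable_fun `[0%R, T]
      (fun s => (enorm (Hq k s w - dx psi s x w) ^+ 2)%:E)}.
    apply: ae_foralln => k.
    exact: (ae_measurable_sqr (jointly_measurable_sub (jk k) jH) (ltW T0)).
  apply: filterS3 mk psiC (psiK _ _ K_cpt K_pos T0) => w {}mk {}psiC psi_fin.
  set I := (X in (X < _)%E) in psi_fin.
  have I0 : (0 <= I)%E by apply: integral_ge0 => s _; apply: expe_ge0; exact: psi_norm0.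
  have Ifin : I \is a fin_num by rewrite ge0_fin_numE.
  have bound k : (sqr_L2dist T (Hq k) (fun t w => dx psi t x w) w <=
      (n.+1%:R * h k ^+ 2)%R%:E * I)%E.
    apply: integral_le_scaled; [exact: measurable_itv| |exact: mk|by []| | |].
    + by rewrite mulr_gt0 // exprn_gt0.
    + by move=> s _; rewrite lee_fin sqr_ge0.
    + by move=> s _; apply: expe_ge0; exact: psi_norm0.
    move=> s; rewrite /= in_itv /= => /andP[s0 _]; have [psiC2 _] := psiC s s0.
    exact: (quotient_error_seminorm_rV delta x0 (h01 k) psiC2).
  pose c := n.+1%:R * fine I; have c0 : 0 <= c by rewrite mulr_ge0 // fine_ge0.
  have ec : 0 < e / (c + 1) by rewrite divr_gt0 // ltr_wpDl.
  have [K hK] := invr_succ_lt ec; exists K => k Kk.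
  apply: le_trans (bound k) _; rewrite -(fineK Ifin) -EFinM lee_fin.
  rewrite -mulrA (mulrC (h k ^+ 2)) mulrA -/c.
  have hkK : h k <= h K by rewrite lef_pV2 ?posrE // ler_nat.
  have hk1 : h k ^+ 2 <= h k.
    by have /andP[_ hk1] := h01 k; rewrite expr2 ler_piMl // ltW.
  apply: (@le_trans _ _ (c * (e / (c + 1)))).
    by rewrite ler_wpM2l // (le_trans hk1) // (le_trans hkK) // ltW.
  rewrite mulrCA ler_piMr ?(ltW e0) // ler_pdivrMr ?ltr_wpDl // mul1r lerDl //.
(* The stochastic integrals of the quotients equal the quotients of [G] minus
   those of its initial value and of its drift, and all of these converge. *)
- have GMk := ae_foralln (fun k => (MkP k).2).
  apply: filterS3 (filterI drift_ok (filterI iphi (ae_foralln iphik)))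
    (filterI GM0 GMk) (filterI GC Gcont).
  move=> w [ok [iphi' iphik']] [{}GM0 {}GMk] [{}GC {}Gcont] T e T0 e0.
  have [C hC] := continuous_field_bounded T Gcont x0.
  have C0 : 0 <= C.
    apply: le_trans (hC 0 x _ _); rewrite ?normr_ge0 ?lexx ?(ltW T0) //.
    by rewrite /right_segment /= in_itv /= lexx lerDl ler01.
  have Gerr k t : 0 <= t <= T ->
      `|(h k)^-1 * (G t (h k + x) w - G t x w) - dx G t x w| <= h k * C.
    move=> tT; have /andP[t0 _] := tT; have [dG _] := GC t t0.
    apply: (@quotient_error_le _ (G t ^~ w) (dx G t ^~ w) (dx (dx G) t ^~ w)
      x (h k) C (h0 k)).
    + move=> z /andP[xz _]; apply: derive1_is_derive.
      exact: (dG 0%N z isT (lt_le_trans x0 xz)).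
    + move=> z /andP[xz _]; apply: derive1_is_derive.
      exact: (dG 1%N z isT (lt_le_trans x0 xz)).
    + have /andP[_ hk1] := h01 k.
      by move=> z /(right_segment_sub hk1) xz; exact: hC.
  have [idphi iqT [C' C'0 hC']] := ok T T0.
  pose c := C + C + C'; have c0 : 0 <= c by rewrite !addr_ge0.
  have ec : 0 < e / (c + 1) by rewrite divr_gt0 // ltr_wpDl.
  have [K hK] := invr_succ_lt ec; exists K => k Kk t tT; have /andP[t0 tT'] := tT.
  have sub : (`[0, t]%classic : set R) `<=` `[0, T]%classic.
    by apply: subset_itvl; rewrite bnd_simp.
  have it f : lebesgue_measure.-integrable `[0, T] f ->
      lebesgue_measure.-integrable `[0, t] f.
    by move=> fi; apply: integrableS fi.
  have Ierr : `|\int[lebesgue_measure]_(s in `[0, t]) q k s w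
      - \int[lebesgue_measure]_(s in `[0, t]) dx phi s x w| <= h k * C'.
    rewrite -RintegralB //; [|exact: it (iqT k)|exact: it idphi].
    have iqd : lebesgue_measure.-integrable `[0, T]
        (fun s => (q k s w - dx phi s x w)%:E).
      by apply: (integrableB _ (iqT k) idphi).
    apply: le_trans (le_normr_Rintegral _ _) _ => //; first exact: it iqd.
    rewrite -lee_fin; apply: le_trans (hC' k).
    rewrite fineK; last first.
      by apply: integrable_fin_num => //; apply: integrable_norm; exact: it iqd.
    exact: ge0_le_lower_integral.
  have qE : \int[lebesgue_measure]_(s in `[0, t]) q k s w = (h k)^-1 *
      (\int[lebesgue_measure]_(s in `[0, t]) phi s (h k + x) w
       - \int[lebesgue_measure]_(s in `[0, t]) phi s x w).
    rewrite -RintegralB //; [|exact: it (iphik' k T T0)|exact: it (iphi' T T0)].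
    rewrite -RintegralZl //.
    by apply: (integrableB _ (it _ (iphik' k T T0)) (it _ (iphi' T T0))).
  have ME : Mq k t w - M t w =
      ((h k)^-1 * (G t (h k + x) w - G t x w) - dx G t x w)
      - ((h k)^-1 * (G 0 (h k + x) w - G 0 x w) - dx G 0 x w)
      - (\int[lebesgue_measure]_(s in `[0, t]) q k s w
         - \int[lebesgue_measure]_(s in `[0, t]) dx phi s x w).
    rewrite (GMk k t t0) (GM0 t t0) qE /Mq /M; ring.
  rewrite ME; apply: (@le_trans _ _ (h k * c)).
    rewrite [leRHS](_ : _ = h k * C + h k * C + h k * C'); last by rewrite /c; ring.
    apply: le_trans (ler_normB _ _) _; apply: lerD Ierr.
    apply: le_trans (ler_normB _ _) _; apply: lerD; apply: Gerr => //.
    by rewrite lexx ltW.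
  have hkK : h k <= h K by rewrite lef_pV2 ?posrE // ler_nat.
  apply: (@le_trans _ _ (e / (c + 1) * c)).
    by rewrite ler_wpM2r // (le_trans hkK) // ltW.
  by rewrite mulrAC ler_pdivrMr ?ltr_wpDl // ler_wpM2l ?(ltW e0) // lerDl.
Qed.

End DifferentiatedField.

(** * The equation of the marginal utility *)

Theorem proposition4p1 (R : realType) (n : nat)
  (d : measure_display) (Omega : measurableType d) (P : probability Omega R)
  (F : R -> set (set Omega)) (W : R -> Omega -> 'rV[R]_n)
  (hF : filtration F) (hFrc : right_continuous_filtration F)
  (hFc : complete_filtration F P) (hF0 : trivial_at_0 F P)
  (hW : brownian_motion F P W)
  (r : R -> Omega -> R) (eta : R -> Omega -> 'rV[R]_n)
  (Rsp : R -> Omega -> {vspace 'rV[R]_n})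
  (hr : progressive F r) (heta : progressive F eta)
  (hint : forall T, 0 < T ->
    {ae P, forall w, (\int[lebesgue_measure]_(t in `[0%R, T])
                        (`|r t w| + enorm (eta t w) ^+ 2)%:E < +oo)%E})
  (hRsp : forall v, progressive F (fun t w => proj_on (Rsp t w) v))
  (delta : R) (hdelta : 0 < delta)
  (U beta : R -> R -> Omega -> R) (gamma : R -> R -> Omega -> 'rV[R]_n)
  (hU : progressive_utility F P U)
  (hreg : K_regular F P W 2 delta U beta gamma)
  (hC3 : {ae P, forall w, forall t, 0 <= t -> class_C 3 (U t ^~ w)})
  (hHJB : {ae P, forall w, forall t x, 0 <= t -> 0 < x ->
     hjb_constraints (U t ^~ w) (gamma t ^~ w)
       (Rsp t w) (r t w) (eta t w) (beta t ^~ w) x}) :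
  {ae P, forall w, forall t, 0 <= t ->
     (* U_x(t,.) is decreasing *)
     (forall x y, 0 < x -> x < y -> dx U t y w < dx U t x w) /\
     (* the derivatives in the coefficients of the SPDE exist, the one of
        sigma_tilde wherever the division by U_xx makes sense *)
     (forall x, 0 < x ->
        derivable
          (fun z => enorm (sigma_star (U t ^~ w)
             (gamma t ^~ w) (Rsp t w) (eta t w) z) ^+ 2
             * dx (dx U) t z w) x 1 /\
        (dx (dx U) t x w != 0 ->
         derivable (sigma_tilde (U t ^~ w) (gamma t ^~ w)
           (Rsp t w) (eta t w)) (dx U t x w) 1))} /\
  ito_field F P W (dx U)
    (fun t x w => spde_drift (U t ^~ w) (gamma t ^~ w)
       (Rsp t w) (r t w) (eta t w) (dx U t ^~ w) x)
    (fun t x w => spde_diffusion (U t ^~ w) (gamma t ^~ w)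
       (Rsp t w) (eta t w) (dx U t ^~ w) x).
Proof.
have utility_w : {ae P, forall w, forall t, 0 <= t -> utility_function (U t ^~ w)}.
  by apply: filterS hU.2 => w [].
have coeff_w : {ae P, forall w, forall t, 0 <= t ->
    class_C 2 (beta t ^~ w) /\ class_C 2 (gamma t ^~ w)}.
  have [_ _ [_ betaC _] [_ gammaC _]] := hreg.
  by apply: filterS2 betaC gammaC => w b g t t0; split; [case: (b t t0)|case: (g t t0)].
split.
  apply: filterS2 (filterI utility_w hC3) (filterI coeff_w hHJB).
  move=> w [hu hu3] [hbg hjb] t t0; have [hb hg] := hbg t t0.
  have hjbt x x0 := hjb t x t0 x0.
  split; first by move=> x y; exact: (utility_derive1_decreasing (hu t t0) (hu3 t t0)).
  move=> x x0; split.
    exact: (derivable_sigma_sqr (hu3 t t0) hb hjbt x0).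
  by move=> ux0; exact (derivable_sigma_tilde (hu t t0) (hu3 t t0) hg x0 ux0).
apply: (ito_field_ae_eq hF hFc hW (phi := dx beta) (psi := dx gamma)).
  apply: (ito_field_dx hF hFc hW hreg).
    by apply: filterS utility_w => w hu t /hu[[]].
  by apply: filterS hU.2 => w [_ []].
apply: filterS2 (filterI utility_w hC3) (filterI coeff_w hHJB).
move=> w [hu hu3] [hbg hjb] t x t0 x0; have [hb hg] := hbg t t0.
have hjbt z z0 := hjb t z t0 z0; split.
  by rewrite (spde_drift_eq (hu t t0) (hu3 t t0) hb hg hjbt x0).
by rewrite (spde_diffusion_eq hjbt x0).
Qed.
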